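(* Let $G$ be a simple graph with at least one edge and let $s\geq 1$ be an integer such that $G$ contains no cycle of odd length at most $2s-3$. Then $${\rm reg}\big(I(G)^{(s+1)}\big)\leq \max\big\{{\rm reg}(I(G))+2s,\ {\rm reg}(I(G)^s)\big\}.$$
   Context: $S=\mathbb{K}[x_1,\dots,x_n]$ over a field $\mathbb{K}$; vertices of $G$ are the variables. $I(G)$ is the edge ideal and $I(G)^{(s)}=\bigcap_{C\in\mathcal{C}(G)}\mathfrak{p}_C^s$, where $\mathcal{C}(G)$ is the set of minimal vertex covers and $\mathfrak{p}_C$ is generated by the variables in $C$. ${\rm reg}$ is Castelnuovo–Mumford regularity. *)

(* Defs.v *)
From HB Require Import structures.
From mathcomp Require Import all_boot all_order all_algebra.
From Stdlib Require Import ClassicalEpsilon.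
Set Implicit Arguments. Unset Strict Implicit. Unset Printing Implicit Defensive.
Import Order.TTheory GRing.Theory Num.Theory.

(* S = K[x_0,...,x_{n-1}]; a monomial x^b is its exponent vector b. *)
Definition mono (n : nat) := {ffun 'I_n -> nat}.

(* A monomial ideal of S is represented by the (boolean) set of exponent
   vectors of the monomials it contains (it is the K-span of them). *)
Definition monideal (n : nat) := mono n -> bool.

Section Graph.
Variable n : nat.
Variable e : rel 'I_n.

Definition edge_ideal : monideal n :=
  fun b => [exists i, exists j, [&& e i j, 0 < b i & 0 < b j]].

(* I(G)^s : generated by products of s edge monomials. x^b lies in it iff
   there is a multiset c of s edges (c p = multiplicity of the edge p) whose
   product divides x^b. *)
Definition edge_ideal_pow (s : nat) : monideal n :=
  fun b => [exists c : {ffun 'I_n * 'I_n -> 'I_s.+1},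
     [&& (\sum_p (c p : nat) == s)%N,
         [forall p, (0 < c p)%N ==> e p.1 p.2] &
         [forall v, (\sum_p (c p : nat) * ((p.1 == v) + (p.2 == v)) <= b v)%N]]].

Definition vertex_cover (C : {set 'I_n}) : bool :=
  [forall i, forall j, e i j ==> (i \in C) || (j \in C)].

Definition min_vertex_cover (C : {set 'I_n}) : bool :=
  vertex_cover C && [forall D : {set 'I_n}, (D \proper C) ==> ~~ vertex_cover D].

(* I(G)^(s) = \bigcap_{C minimal vertex cover} p_C^s ; x^b in p_C^s iff
   the degree of x^b in the variables of C is at least s. *)
Definition symb_pow (s : nat) : monideal n :=
  fun b => [forall C : {set 'I_n}, min_vertex_cover C ==> (s <= \sum_(v in C) b v)%N].

Definition has_cycle_of_length (l : nat) : Prop :=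
  exists p : seq 'I_n, [/\ size p = l, (3 <= l)%N, uniq p & cycle e p].
End Graph.

(* Multigraded Betti numbers beta_{i,b}(I) = dim_K Tor_i^S(I,K)_b, computed
   as the homology of the Koszul complex K(x_1..x_n; I) in multidegree b. *)
Section Koszul.
Variable K : fieldType.
Variable n : nat.
Variable I : monideal n.

Definition shift (b : mono n) (F : {set 'I_n}) : mono n :=
  [ffun k => b k - (k \in F)].

(* K-basis of (I (x) /\^i K^n)_b : elements x^{b - e_F} e_F, |F| = i *)
Definition kbasis (i : nat) (b : mono n) : {set {set 'I_n}} :=
  [set F : {set 'I_n} | [&& #|F| == i, [forall k in F, 0 < b k] & I (shift b F)]].

(* matrix of the Koszul differential d_{i+1} : C_{i+1,b} -> C_{i,b},
   d(e_F) = sum_{k in F} (-1)^{#{l in F, l < k}} x_k e_{F \ k},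
   written on the basis of all subsets (entries zero outside the bases). *)
Definition kdiff (i : nat) (b : mono n) :
  'M[K]_(#|{: {set 'I_n}}|, #|{: {set 'I_n}}|) :=
  \matrix_(r, c)
    (let F := (enum_val r : {set 'I_n}) in let G := (enum_val c : {set 'I_n}) in
     if (F \in kbasis i.+1 b) && (G \in kbasis i b) then
       (\sum_(k in F | G == F :\ k) (-1) ^+ #|[set l in F | (l < k)%N]|)%R
     else 0%R).

Definition betti (i : nat) (b : mono n) : nat :=
  (#|kbasis i b| - \rank (kdiff i b)
     - (if i is i'.+1 then \rank (kdiff i' b) else 0))%N.

Definition is_reg (r : int) : Prop :=
  (forall i b, betti i b <> 0%N -> (Posz (\sum_k b k) - Posz i <= r)%R) /\
  (exists i b, betti i b <> 0%N /\ (Posz (\sum_k b k) - Posz i)%R = r).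

Definition reg : int := epsilon (inhabits 0%R) is_reg.
End Koszul.

(* Main.v *)
Require Import Defs.
From mathcomp Require Import all_boot all_order all_algebra.
From mathcomp Require Import zify.
From Stdlib Require Import ClassicalEpsilon Classical.
Set Implicit Arguments. Unset Strict Implicit. Unset Printing Implicit Defensive.
Import Order.TTheory GRing.Theory Num.Theory.

(** Write J = I^(s+1) and L = I^s.  The cycle condition gives that J is contained
in L, so a nonzero Betti number of J in multidegree b comes either from L or
from L/J.  Filter L/J by the lexicographically largest product m of s edges
dividing a monomial.  A monomial of L outside J has degree exactly s on some
minimal cover, so the products of s edges dividing it are the bases of a
transversal polymatroid; the exchange property yields linear quotients, and the
graded pieces are quotients by (J : m) plus some variables.  The ideal (J : m)
is squarefree; its complex is obtained from the independence complex of G by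
replacing it, for each edge xy of m in turn, by the union of the stars of x and
y.  These complexes stay flag, and a Mayer-Vietoris and suspension argument
shows that if the union has cohomology in some degree on some vertex set, then
so has the original complex on another vertex set; by Hochster's formula
reg (J : m) <= reg I. *)

(** * Homology of convex families of faces *)

(** Regularity depends only on which homology groups vanish, so exact sequences are used as
    dichotomies between nonvanishing groups, without maps or dimensions. Koszul strands of ideals
    and quotients and unions of stars are all subquotients of one simplex, that is, convex families
    of faces with a common boundary formula.

    The constant 2s is the degree of m: where a graded piece has homology in multidegree b, the
    cofactor b/m is forced to be squarefree, on a set W with |b| = |W| + 2s.

    Flagness is what permits the comparison with G: the star of a vertex and the intersection of two
    stars are then induced subcomplexes, and adding the non-adjacent x and y to the intersection
    suspends it, which restores the degree lost in Mayer-Vietoris.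

    For J inside L, odd cycles of length 2s-1 are still allowed. Koenig duality settles bipartite
    supports; a critical odd cycle supplies only s-1 disjoint edges, and the last edge must be found
    elsewhere or its absence must produce a cover of too small degree. *)

Section Homology.
Local Open Scope ring_scope.
Variables (K : fieldType) (n : nat).
Implicit Types (F G H T W : {set 'I_n}) (P Q : pred {set 'I_n}) (z y : {set 'I_n} -> K).

Definition sg (k : 'I_n) G : K := (-1) ^+ #|[set l in G | (l < k)%N]|.

(** This is the boundary of the full simplex; a family enters only through the support of [z] and
    the faces at which [bd z] is tested. *)
Definition bd z G : K := \sum_(k | k \notin G) sg k G * z (k |: G).

Definition chain P (i : nat) z := forall F, z F != 0 -> P F && (#|F| == i).

Definition convex P := forall F G H, F \subset G -> G \subset H -> P F -> P H -> P G.

(* The complex of a convex family is a subquotient of the simplex, its faces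
   being those of [P]; [nzH P i] says that its homology at the faces of
   cardinality [i] does not vanish. *)
Definition nzH P i := exists z, [/\ chain P i z, forall G, P G -> bd z G = 0 &
  forall y, chain P i.+1 y -> ~ (forall G, P G -> bd y G = z G)].

Lemma sgU k l G : l \notin G -> sg k (l |: G) = (-1) ^+ (l < k)%N * sg k G.
Proof.
move=> lG; rewrite /sg -exprD; congr (_ ^+ _).
case: (boolP (l < k)%N) => lk.
  have -> : [set m in l |: G | (m < k)%N] = l |: [set m in G | (m < k)%N].
    by apply/setP=> m; rewrite !inE; have [->|] := eqVneq m l; rewrite ?lk.
  by rewrite cardsU1 !inE (negPf lG).
rewrite add0n; apply: eq_card => m; rewrite !inE.
have [->|] := eqVneq m l; by rewrite ?(negPf lk) ?andbF.
Qed.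

Lemma sg_sq k G : sg k G * sg k G = 1.
Proof. by rewrite /sg -exprD addnn -mul2n exprM sqrrN expr1n expr1n. Qed.

Lemma sg_swap k l G : k != l -> k \notin G -> l \notin G ->
  sg k G * sg l (k |: G) = - (sg l G * sg k (l |: G)).
Proof.
move=> kl kG lG; rewrite !sgU //.
have [lk|lk|/val_inj E] := ltngtP k l; last by rewrite E eqxx in kl.
  by rewrite expr1 expr0 mul1r mulN1r mulrN mulrC.
by rewrite expr1 expr0 mul1r mulN1r mulrN opprK mulrC.
Qed.

Lemma sgU_sgU k l G : k != l -> k \notin G -> l \notin G ->
  sg l (k |: G) * sg k (l |: G) = - (sg k G * sg l G).
Proof.
move=> kl kG lG; rewrite !sgU //.
have [?|?|/val_inj E] := ltngtP k l; last by rewrite E eqxx in kl.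
  by rewrite expr1 expr0 mul1r mulN1r mulNr mulrC.
by rewrite expr1 expr0 mul1r mulN1r mulrN mulrC.
Qed.

Lemma bd_bd z G : bd (bd z) G = 0.
Proof.
pose A k l := sg k G * (sg l (k |: G) * z (l |: (k |: G))).
have E : bd (bd z) G = \sum_(k | k \notin G) \sum_(l | (l \notin G) && (l != k)) A k l.
  rewrite /bd; apply: eq_bigr => k kG; rewrite big_distrr /=.
  by apply: eq_bigl => l; rewrite !inE negb_or andbC.
rewrite E.
have -> : \sum_(k | k \notin G) \sum_(l | (l \notin G) && (l != k)) A k l =
  \sum_(k | k \notin G) \sum_(l | (l \notin G) && (l < k)%N) A k l +
  \sum_(k | k \notin G) \sum_(l | (l \notin G) && (k < l)%N) A k l.
  rewrite -big_split /=; apply: eq_bigr => k kG.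
  rewrite (bigID (fun l : 'I_n => (l < k)%N)) /=; congr (_ + _); apply: eq_bigl => l.
    by rewrite -andbA; congr (_ && _); rewrite -val_eqE /=; case: ltngtP.
  by rewrite -andbA; congr (_ && _); rewrite -val_eqE /=; case: ltngtP.
rewrite [X in _ + X](exchange_big_dep (fun l : 'I_n => l \notin G)) /=;
  last by move=> ? ? _ /andP[].
rewrite -big_split /=; apply: big1 => k kG.
rewrite [X in _ + X](eq_bigl (fun l : 'I_n => (l \notin G) && (l < k)%N)); last first.
  by move=> l; rewrite kG.
rewrite -big_split /=; apply: big1 => l /andP[lG lk].
have kl : k != l by rewrite -val_eqE; case: ltngtP lk.
by rewrite /A !mulrA sg_swap // setUCA mulNr addNr.
Qed.

Lemma eq_bd z y G : (forall k, k \notin G -> z (k |: G) = y (k |: G)) -> bd z G = bd y G.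
Proof. by move=> E; apply: eq_bigr => k kG; rewrite E. Qed.

Lemma bdB z y G : bd (fun F => z F - y F) G = bd z G - bd y G.
Proof. by rewrite /bd -sumrB; apply: eq_bigr => k _; rewrite mulrBr. Qed.

Lemma bdD z y G : bd (fun F => z F + y F) G = bd z G + bd y G.
Proof. by rewrite /bd -big_split; apply: eq_bigr => k _; rewrite mulrDr. Qed.

Lemma bd_neq0 z G : bd z G != 0 -> exists2 k, k \notin G & z (k |: G) != 0.
Proof.
move=> N; have [/existsP[k /andP[]]|/existsPn Z] :=
  boolP [exists k, (k \notin G) && (z (k |: G) != 0)]; first by exists k.
case/eqP: N; apply: big1 => k kG; have := Z k; rewrite kG /= negbK => /eqP->.
by rewrite mulr0.
Qed.

Definition res P z F : K := if P F then z F else 0.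

(* Faces outside [P] that carry part of [bd z] contain no face of [P], by
   convexity. *)
Lemma bd_res_bd P i z G : convex P -> chain P i z -> P G -> bd (res P (bd z)) G = 0.
Proof.
move=> cP Cz PG; rewrite -(bd_bd z G); apply: eq_bd => k kG; rewrite /res.
case: ifP => // NP; apply/esym/eqP; apply: contraFT NP => /bd_neq0 [l lk /Cz/andP[PF _]].
by apply: (cP _ _ _ _ _ PG PF); rewrite subsetUr.
Qed.

Lemma chain_res_bd P i z : chain P i.+1 z -> chain P i (res P (bd z)).
Proof.
move=> Cz F; rewrite /res; case: ifP => [PF|]; last by rewrite eqxx.
by case/bd_neq0=> k kF /Cz/andP[_]; rewrite cardsU1 kF eqSS.
Qed.

Lemma nzH_eq P Q i : P =1 Q -> nzH P i -> nzH Q i.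
Proof.
move=> E [z [Cz Zz Nz]]; exists z; split=> [F /Cz|G|y Cy Y]; rewrite -?E //; first exact: Zz.
by apply: (Nz y) => [F /Cy|G]; rewrite E //; apply: Y.
Qed.

Lemma nzH_ex P i : nzH P i -> exists2 F, P F & #|F| = i.
Proof.
move=> [z [Cz Zz Nz]].
have [/existsP[F /andP[PF /eqP]]|/existsPn Z] := boolP [exists F, P F && (#|F| == i)].
  by exists F.
case: (Nz (fun=> 0)) => [F|G PG]; first by rewrite eqxx.
rewrite /bd big1 => [|k _]; last by rewrite mulr0.
by apply/esym/eqP; apply: contraNT (Z G) => /Cz.
Qed.

(** * Long exact sequence of a subcomplex [P1] with quotient [P2] *)

Section Exact.
Variables (P P1 P2 : pred {set 'I_n}).
Hypotheses (cP : convex P) (PE : forall F, P F = P1 F || P2 F)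
  (P12 : forall F, P1 F -> ~~ P2 F)
  (dP : forall F G, G \subset F -> P1 F -> P G -> P1 G).

Let PP1 F : P1 F -> P F. Proof. by rewrite PE => ->. Qed.
Let PP2 F : P2 F -> P F. Proof. by rewrite PE orbC => ->. Qed.

Let bd2 z G : (forall F, z F != 0 -> P F) -> P2 G -> bd (res P2 z) G = bd z G.
Proof.
move=> Cz PG; apply: eq_bd => k kG; rewrite /res; case: ifP => // N2.
apply/esym/eqP; apply/negP=> /negP /Cz; rewrite PE N2 orbF => N1.
by have := P12 (dP (subsetUr _ _) N1 (PP2 PG)); rewrite PG.
Qed.

Let bd1 z G : (forall F, z F != 0 -> P1 F) -> P2 G -> bd z G = 0.
Proof.
move=> Cz PG; apply/eqP/negP=> /negP /bd_neq0[k kG /Cz P1k].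
by have := P12 (dP (subsetUr _ _) P1k (PP2 PG)); rewrite PG.
Qed.

Let chain1 i z : chain P1 i z -> chain P i z.
Proof. by move=> C F /C/andP[/PP1-> ->]. Qed.
Let chain2 i z : chain P2 i z -> chain P i z.
Proof. by move=> C F /C/andP[/PP2-> ->]. Qed.
Let chP i z : chain P i z -> forall F, z F != 0 -> P F.
Proof. by move=> C F /C/andP[]. Qed.
Let chP1 i z : chain P1 i z -> forall F, z F != 0 -> P1 F.
Proof. by move=> C F /C/andP[]. Qed.
Let chres2 i z : chain P i z -> chain P2 i (res P2 z).
Proof. by move=> C F; rewrite /res; case: ifP => [F2 /C/andP[_ ->]|]; rewrite ?eqxx ?F2. Qed.

Let res_bd_cycle i y : chain P2 i y -> forall G, P G -> bd (res P (bd y)) G = 0.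
Proof. by move=> Cy G PG; apply: (bd_res_bd (i := i)) => //; apply: chain2. Qed.

(** Exactness at the middle: if the image of [z] in the quotient bounds [y], subtracting the
    boundary of [y] moves [z] into [P1]. *)
Lemma nzH_split i : nzH P i -> nzH P1 i \/ nzH P2 i.
Proof.
move=> [z [Cz Zz Nz]]; apply: NNPP => /not_or_and[H1 H2].
case: H2; exists (res P2 z); split; first exact: chres2.
  by move=> G PG; rewrite bd2 ?Zz ?PP2 //; apply: chP Cz.
move=> y Cy Y; case: H1; exists (fun F => z F - res P (bd y) F); split.
- move=> F N; have /andP[PF ->] : P F && (#|F| == i).
    have [z0|/Cz //] := eqVneq (z F) 0.
    by apply: (chain_res_bd (chain2 Cy)); move: N; rewrite z0 sub0r oppr_eq0.
  rewrite andbT; move: PF; rewrite PE => /orP[//|PF].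
  by move: N; rewrite /res PP2 // Y // /res PF subrr eqxx.
- by move=> G PG; rewrite bdB Zz ?(res_bd_cycle Cy) ?subr0 ?PP1.
move=> x Cx X; apply: (Nz (fun F => x F + y F)).
  move=> F; have [x0|/Cx/andP[/PP1-> ->]//] := eqVneq (x F) 0.
  by rewrite x0 add0r => /Cy/andP[/PP2-> ->].
move=> G PG; rewrite bdD; case: (boolP (P1 G)) => [G1|G1].
  by rewrite X // /res PG subrK.
have G2 : P2 G by move: PG; rewrite PE (negPf G1).
by rewrite bd1 ?add0r ?Y // /res ?G2 //; apply: chP1 Cx.
Qed.

(** Exactness at the quotient: the connecting map sends [z] to the part of [bd z] on [P1]; if that
    is a boundary, [z] lifts to a cycle of [P]. *)
Lemma nzH_quot i : nzH P2 i -> nzH P i \/ exists2 i', i = i'.+1 & nzH P1 i'.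
Proof.
move=> [z [Cz Zz Nz]]; apply: NNPP => /not_or_and[HP H1].
suff [y Cy Y] : exists2 y, chain P1 i y & forall G, P1 G -> bd y G = bd z G.
  case: HP; exists (fun F => z F - y F); split.
  - move=> F; have [z0|/Cz/andP[/PP2-> ->]//] := eqVneq (z F) 0.
    by rewrite z0 sub0r oppr_eq0 => /Cy/andP[/PP1-> ->].
  - move=> G; rewrite PE bdB => /orP[G1|G2]; first by rewrite Y ?subrr.
    by rewrite Zz // sub0r bd1 ?oppr0 //; apply: chP1 Cy.
  move=> x Cx X; apply: (Nz (res P2 x)); first exact: chres2.
  move=> G PG; rewrite bd2 ?X ?PP2 //; last exact: chP Cx.
  have [->|/Cy/andP[/P12]] := eqVneq (y G) 0; first by rewrite subr0.
  by rewrite PG.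
case: i Cz Nz HP H1 => [|i] Cz Nz HP H1.
  exists (fun=> 0) => [F|G PG]; first by rewrite eqxx.
  rewrite /bd !big1 // => k kG; rewrite ?mulr0 //.
  have [->|/Cz/andP[_]] := eqVneq (z (k |: G)) 0; first by rewrite mulr0.
  by rewrite cardsU1 kG.
apply: NNPP => N; apply: H1; exists i => //; exists (res P1 (bd z)); split.
- move=> F; rewrite /res; case: ifP => F1; last by rewrite eqxx.
  by move=> N0; have := @chain_res_bd P i z (chain2 Cz) F; rewrite /res PP1 // => /(_ N0).
- move=> G PG; rewrite -(res_bd_cycle Cz (PP1 PG)); apply: eq_bd => k kG.
  rewrite /res PE; case: ifP => //= N1; case: ifP => // N2; exact/esym/Zz.
by move=> y Cy Y; apply: N; exists y => // G PG; rewrite Y // /res PG.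
Qed.

(** Exactness at the subcomplex: if [z] bounds [y] in [P], the part of [y] on [P2] is a cycle that
    the connecting map sends to [z]. *)
Lemma nzH_sub i : nzH P1 i -> nzH P i \/ nzH P2 i.+1.
Proof.
move=> [z [Cz Zz Nz]]; apply: NNPP => /not_or_and[HP H2].
case: HP; exists z; split; first exact: chain1.
  move=> G; rewrite PE => /orP[/Zz//|G2]; apply: bd1 => //; exact: chP1 Cz.
move=> y Cy Y; case: H2; exists (res P2 y); split; first exact: chres2.
  move=> G PG; rewrite bd2 ?Y ?PP2 //; last exact: chP Cy.
  by apply/eqP/negP=> /negP/Cz/andP[/P12]; rewrite PG.
move=> x Cx X; apply: (Nz (fun F => y F - res P (bd x) F)).
  move=> F N; have /andP[PF ->] : P F && (#|F| == i.+1).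
    have [y0|/Cy //] := eqVneq (y F) 0.
    by apply: (chain_res_bd (chain2 Cx)); move: N; rewrite y0 sub0r oppr_eq0.
  rewrite andbT; move: PF; rewrite PE => /orP[//|PF].
  by move: N; rewrite /res PP2 // X // /res PF subrr eqxx.
by move=> G PG; rewrite bdB Y ?(res_bd_cycle Cx) ?subr0 ?PP1.
Qed.
End Exact.

(** Coning with apex [k] is a contracting homotopy: [y] carries [z] to the faces containing [k], and
    the cycle condition at [G'] gives the value of [bd y] at [k |: G']. *)
Lemma nzH_cone P k i : (forall F, k \notin F -> P (k |: F) = P F) -> ~ nzH P i.
Proof.
move=> tP [z [Cz Zz Nz]].
pose y F := if k \in F then sg k (F :\ k) * z (F :\ k) else 0.
apply: (Nz y) => [F|G PG].
  rewrite /y; case: ifP => kF; last by rewrite eqxx.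
  have [->|/Cz/andP[PF /eqP cF] _] := eqVneq (z (F :\ k)) 0; first by rewrite mulr0 eqxx.
  by rewrite -(setD1K kF) tP ?PF ?setD11 // cardsU1 setD11 cF add1n eqxx.
have [kG|kG] := boolP (k \in G); last first.
  rewrite /bd (bigD1 k) //= big1 ?addr0 => [|l /andP[lG lk]].
    by rewrite /y setU11 setU1K // mulrA sg_sq mul1r.
  by rewrite /y !inE eq_sym (negPf lk) (negPf kG) mulr0.
have [G' kG' GE] : exists2 G' : {set 'I_n}, k \notin G' & G = k |: G'.
  by exists (G :\ k); rewrite ?setD11 ?setD1K.
rewrite {}GE {kG} in PG *.
have PG' : P G' by rewrite -tP.
have := Zz G' PG'; rewrite {1}/bd (bigD1 k) //= => E.
have -> : bd y (k |: G') = - (sg k G' * \sum_(l | (l \notin G') && (l != k)) sg l G' * z (l |: G')).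
  rewrite /bd big_distrr -sumrN /=; apply: eq_big => [l|l].
    by rewrite !inE negb_or andbC.
  rewrite !inE negb_or => /andP[lk lG'].
  have -> : y (l |: (k |: G')) = sg k (l |: G') * z (l |: G').
    rewrite /y !inE eqxx orbT; suff -> : (l |: (k |: G')) :\ k = l |: G' by [].
    by rewrite setUCA setU1K // !inE negb_or eq_sym lk.
  by rewrite mulrA sgU_sgU 1?eq_sym // mulNr mulrA.
move/eqP: E; rewrite addr_eq0 => /eqP E.
by rewrite -[\sum_(_ | _) _]opprK -E mulrN opprK mulrA sg_sq mul1r.
Qed.
End Homology.

(** * Betti numbers and Koszul homology *)

Section Betti.
Local Open Scope ring_scope.
Variables (K : fieldType) (n : nat).
Implicit Types (F G : {set 'I_n}) (b c : mono n) (I J : monideal n).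

Definition upclosed I := forall b c, (forall v, b v <= c v)%N -> I b -> I c.

Definition koszul I b : pred {set 'I_n} :=
  fun F => [forall k in F, (0 < b k)%N] && I (shift b F).

Lemma shift_anti b F G : F \subset G -> forall v, (shift b G v <= shift b F v)%N.
Proof.
move=> /subsetP FG v; rewrite !ffunE leq_sub2l //.
by have [/FG->|] := boolP (v \in F).
Qed.

Lemma koszul_down I b F G : upclosed I -> G \subset F -> koszul I b F -> koszul I b G.
Proof.
move=> up GF /andP[/forall_inP b0 IF]; apply/andP; split.
  by apply/forall_inP=> k /(subsetP GF)/b0.
exact: up (shift_anti _ GF) IF.
Qed.

Section Bridge.
Variables (I : monideal n) (b : mono n).
Hypothesis up : upclosed I.
Let N := #|{: {set 'I_n}}|.
Let P := koszul I b.

Let kbE i F : (F \in kbasis I i b) = P F && (#|F| == i).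
Proof. by rewrite inE andbC. Qed.

Let fun_of (v : 'rV[K]_N) F := v 0 (enum_rank F).
Let vec_of (z : {set 'I_n} -> K) : 'rV[K]_N := \row_r z (enum_val r).

Let fun_vec z F : fun_of (vec_of z) F = z F.
Proof. by rewrite /fun_of mxE enum_rankK. Qed.

Let mul_kdiff i v G : (fun_of (v *m kdiff K I i b) G) =
  if P G && (#|G| == i) then bd (fun F => if P F && (#|F| == i.+1) then fun_of v F else 0) G else 0.
Proof.
rewrite /fun_of mxE; have [GP|GP] := ifP; last first.
  by apply: big1 => r _; rewrite mxE /= enum_rankK !kbE GP andbF mulr0.
rewrite (reindex (@enum_rank _)) /=; last first.
  by apply: onW_bij; exists enum_val; [exact: enum_rankK|exact: enum_valK].
rewrite (eq_bigr (fun F => \sum_(k in F | G == F :\ k)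
   (if P F && (#|F| == i.+1) then v 0 (enum_rank F) else 0) * sg K k F)); last first.
  move=> F _; rewrite mxE /= !enum_rankK !kbE GP andbT; case: ifP => _.
    by rewrite big_distrr.
  by rewrite mulr0 big1 // => *; rewrite mul0r.
rewrite (exchange_big_dep xpredT) //= /bd [RHS]big_mkcond /=.
apply: eq_bigr => k _; have [kG|kG] := boolP (k \in G).
  by rewrite big1 // => F /andP[_ /eqP E]; rewrite E setD11 in kG.
rewrite (big_pred1 (k |: G)) => [|F]; last first.
  apply/andP/eqP => [[kF /eqP ->]|->]; first by rewrite setD1K.
  by rewrite setU11 setU1K.
by rewrite sgU // ltnn expr0 mul1r mulrC.
Qed.

Let base i : 'M[K]_(#|kbasis I i b|, N) :=
  \matrix_(r, j) (enum_val r == enum_val j)%:R.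

Let base_sub i v : (v <= base i)%MS <-> chain P i (fun_of v).
Proof.
split=> [/submxP[u ->] F|C].
  rewrite /fun_of mxE => N0; rewrite -kbE; apply: contraNT N0 => NF.
  apply/eqP/big1 => r _; rewrite mxE enum_rankK.
  case: eqP => [E|_]; last by rewrite mulr0.
  by rewrite -E enum_valP in NF.
apply/submxP; exists (\row_r fun_of v (enum_val r)); apply/rowP=> j.
rewrite mxE; have [jB|jB] := boolP (enum_val j \in kbasis I i b).
  rewrite (bigD1 (enum_rank_in jB (enum_val j))) //= big1 => [|r rj].
    by rewrite !mxE enum_rankK_in // eqxx mulr1 addr0 /fun_of enum_valK.
  rewrite !mxE; case: eqP => [E|_]; last by rewrite mulr0.
  by case/eqP: rj; apply: enum_val_inj; rewrite enum_rankK_in.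
rewrite big1 => [|r _].
  apply/eqP; apply: contraR jB => N0; rewrite kbE; apply: C.
  by rewrite /fun_of enum_valK.
rewrite !mxE; case: eqP => [E|_]; last by rewrite mulr0.
by rewrite -E enum_valP in jB.
Qed.

Let rank_base i : \rank (base i) = #|kbasis I i b|.
Proof.
apply/eqP/row_freeP; exists (base i)^T; apply/matrixP=> r r'; rewrite !mxE.
rewrite (bigD1 (enum_rank (enum_val r))) //= big1 => [|j rj].
  by rewrite !mxE enum_rankK eqxx mul1r addr0 (inj_eq enum_val_inj) eq_sym.
rewrite !mxE; case: eqP => [E|_]; last by rewrite mul0r.
by case/eqP: rj; rewrite E enum_valK.
Qed.

(** [kdiff K I i b] is the differential out of degree [i.+1]; this is the one out of degree [i]. *)
Let prev i : 'M[K]_N := if i is i'.+1 then kdiff K I i' b else 0.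

Let bettiE i : betti K I i b = (#|kbasis I i b| - \rank (kdiff K I i b) - \rank (prev i))%N.
Proof. by case: i => [|i] //; rewrite /betti /prev mxrank0. Qed.

Let convP : convex P.
Proof. by move=> F G H FG GH _; apply: koszul_down. Qed.

Let mul_kdiff_chain i v : chain P i.+1 (fun_of v) -> forall G,
  fun_of (v *m kdiff K I i b) G = res P (bd (fun_of v)) G.
Proof.
move=> C G; rewrite mul_kdiff /res; case: (P G) => //=; case: eqP => cG.
  apply: eq_bd => k kG; case: ifP => // N0.
  by apply/esym/eqP; apply: contraFT N0 => /C.
apply/esym/eqP/negP => /negP/bd_neq0[k kG /C/andP[_]].
by rewrite cardsU1 kG add1n eqSS => /eqP.
Qed.

Let cycle_sub i v : (v <= base i :&: kermx (prev i))%MS <->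
  chain P i (fun_of v) /\ forall G, P G -> bd (fun_of v) G = 0.
Proof.
rewrite sub_capmx; split.
  move=> /andP[/base_sub C /sub_kermxP Z]; split=> // G PG.
  case: i C Z => [|i] C Z; last first.
    by have := mul_kdiff_chain C G; rewrite Z /res PG => <-; rewrite /fun_of mxE.
  apply/eqP/negP => /negP/bd_neq0[k kG /C/andP[_]].
  by rewrite cardsU1 kG.
move=> [C Z]; apply/andP; split; first exact/base_sub.
apply/sub_kermxP; case: i C => [|i] C /=; first by rewrite mulmx0.
apply/rowP=> r; have := mul_kdiff_chain C (enum_val r).
rewrite {1}/fun_of enum_valK => ->; rewrite mxE /res; case: ifP => //; exact: Z.
Qed.

Let img_sub i v : chain P i (fun_of v) -> (v <= kdiff K I i b)%MS <->
  exists2 y, chain P i.+1 y & forall G, P G -> bd y G = fun_of v G.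
Proof.
move=> C; split=> [/submxP[u E]|[y Cy Y]].
  exists (fun F => if P F && (#|F| == i.+1) then fun_of u F else 0) => [F|G PG].
    by case: ifP => //; rewrite eqxx.
  have := mul_kdiff i u G; rewrite -E PG /=; case: ifP => // cG E'.
  rewrite E'; apply/eqP/negP => /negP/bd_neq0[k kG].
  by rewrite cardsU1 kG add1n eqSS cG andbF eqxx.
apply/submxP; exists (vec_of y); apply/rowP => r.
have C' : chain P i.+1 (fun_of (vec_of y)) by move=> F; rewrite fun_vec; apply: Cy.
have := mul_kdiff_chain C' (enum_val r).
rewrite {1}/fun_of enum_valK => ->; rewrite /res.
have -> : v 0 r = fun_of v (enum_val r) by rewrite /fun_of enum_valK.
case: ifP => PG.
  by rewrite -Y //; apply: eq_bd => k _; rewrite fun_vec.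
by apply/eqP; apply: contraFT PG => /C/andP[].
Qed.

Let img_cycle i : (kdiff K I i b <= base i :&: kermx (prev i))%MS.
Proof.
apply/row_subP=> r; set v := row r _.
have E : v = delta_mx 0 r *m kdiff K I i b by rewrite /v rowE.
have C : chain P i (fun_of v).
  move=> F; rewrite E mul_kdiff; case: ifP => //; by rewrite eqxx.
apply/cycle_sub; split=> // G PG.
have /(img_sub C)[y Cy Y] : (v <= kdiff K I i b)%MS by apply: row_sub.
rewrite -(bd_res_bd convP Cy PG); apply: eq_bd => k kG; rewrite /res.
case: ifP => N0; first by rewrite Y.
by apply/eqP; apply: contraFT N0 => /C/andP[].
Qed.

Lemma betti_nzH i : betti K I i b <> 0%N <-> nzH K (koszul I b) i.
Proof.
have rk : \rank (base i :&: kermx (prev i)) = (#|kbasis I i b| - \rank (prev i))%N.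
  (* Rows of [prev i] outside the basis vanish, so restricting to chains keeps the rank. *)
  have -> : \rank (prev i) = \rank (base i *m prev i).
    case: i => [|i]; first by rewrite /prev mulmx0 !mxrank0.
    apply/eqP; rewrite eqn_leq [X in _ && X]mxrankS ?submxMl ?andbT //.
    apply: mxrankS; apply/row_subP => r.
    rewrite rowE; have [rB|rB] := boolP (enum_val r \in kbasis I i.+1 b).
      have /submxP[u ->] : ((delta_mx 0 r : 'rV[K]_N) <= base i.+1)%MS.
        apply/base_sub=> F; rewrite /fun_of mxE eqxx -kbE.
        have [E _|_] := eqVneq (enum_rank F) r; last by rewrite eqxx.
        by rewrite -E enum_rankK in rB.
      by rewrite -mulmxA submxMl.
    suff -> : (delta_mx 0 r : 'rV[K]_N) *m kdiff K I i b = 0 by rewrite sub0mx.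
    by apply/rowP=> j; rewrite -rowE !mxE /= (negPf rB).
  by have := mxrank_mul_ker (base i) (prev i); rewrite rank_base => /(canRL (addKn _)).
have E : betti K I i b = (\rank (base i :&: kermx (prev i)) - \rank (kdiff K I i b))%N.
  by rewrite rk bettiE subnAC.
split=> [N0|[z [Cz Zz Nz]] B0].
  have /rV_subP NS : ~~ (base i :&: kermx (prev i) <= kdiff K I i b)%MS.
    by apply/negP=> /mxrankS; rewrite -subn_eq0 -E => /eqP.
  apply: NNPP => NH; apply: NS => v /cycle_sub[C Z]; apply/(img_sub C).
  apply: NNPP => Y; apply: NH; exists (fun_of v); split=> // y Cy D.
  by apply: Y; exists y.
have S : (base i :&: kermx (prev i) <= kdiff K I i b)%MS.
  have [le <-] := mxrank_leqif_sup (img_cycle i).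
  by rewrite eqn_leq le -subn_eq0 -E B0.
have C : chain P i (fun_of (vec_of z)) by move=> F; rewrite fun_vec; apply: Cz.
have /submx_trans/(_ S)/(img_sub C)[y Cy Y] : (vec_of z <= base i :&: kermx (prev i))%MS.
  apply/cycle_sub; split=> // G PG; rewrite -(Zz G PG).
  by apply: eq_bd => k _; rewrite fun_vec.
by apply: (Nz y Cy) => G PG; rewrite Y // fun_vec.
Qed.
End Bridge.
End Betti.

(** * Existence of the regularity *)

Section Regularity.
Local Open Scope ring_scope.
Variables (K : fieldType) (n : nat).
Implicit Types (F G : {set 'I_n}) (b c : mono n) (I J : monideal n).

(** Membership ignores the part of an exponent beyond [N], as when all minimal generators have
    exponents at most [N]; this bounds the multidegrees with nonzero Betti numbers. *)
Definition stable N I := forall b k, (N < b k)%N -> I b -> I (shift b [set k]).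

Lemma shiftU b k F : k \notin F -> shift b (k |: F) = shift (shift b F) [set k].
Proof.
move=> kF; apply/ffunP=> v; rewrite !ffunE !inE.
by have [->|] := eqVneq v k; rewrite ?(negPf kF) ?subn0.
Qed.

Lemma sum_shift b F : (forall k, k \in F -> 0 < b k)%N ->
  (\sum_k shift b F k + #|F| = \sum_k b k)%N.
Proof.
move=> b0; rewrite -sum1_card [X in (_ + X)%N]big_mkcond -big_split /=.
apply: eq_bigr => k _; rewrite ffunE; case: ifP => [/b0|]; last by rewrite subn0 addn0.
by move=> ?; rewrite subnK.
Qed.

(** When [b k] exceeds [N], adding [k] to a face affects neither condition of [koszul], so the
    family is a cone. *)
Lemma nzH_koszul_le N I b i : upclosed I -> stable N I -> nzH K (koszul I b) i ->
  forall k, (b k <= N)%N.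
Proof.
move=> up st H k; rewrite leqNgt; apply/negP=> Nb.
apply: (@nzH_cone K _ _ k) H => F kF; rewrite /koszul; congr (_ && _).
  apply/forall_inP/forall_inP => b0 l.
    by move=> lF; apply: b0; rewrite inE lF orbT.
  by rewrite !inE => /predU1P[->|/b0//]; apply: leq_ltn_trans Nb.
apply/idP/idP; last by rewrite shiftU //; apply: st; rewrite ffunE (negPf kF) subn0.
by apply: up => v; apply: shift_anti; rewrite subsetUr.
Qed.

(** The class sits on the empty face; a chain bounding it would need a face with one vertex, hence a
    monomial of [I] of smaller degree. *)
Lemma nzH_min_gen I b : I b ->
  (forall c, I c -> (\sum_k b k <= \sum_k c k)%N) -> nzH K (koszul I b) 0.
Proof.
move=> Ib mb; exists (fun F => (F == set0)%:R); split.
- move=> F; have [->|] := eqVneq F set0; last by rewrite eqxx.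
  rewrite cards0 eqxx andbT => _; apply/andP; split; first by apply/forall_inP=> k; rewrite inE.
  by rewrite (_ : shift b set0 = b) //; apply/ffunP=> v; rewrite ffunE inE subn0.
- move=> G _; apply: big1 => k _; case: eqP => [/setP/(_ k)|]; last by rewrite mulr0.
  by rewrite !inE eqxx.
move=> y Cy /(_ set0) E.
have /E/eqP : koszul I b set0.
  apply/andP; split; first by apply/forall_inP=> k; rewrite inE.
  by rewrite (_ : shift b set0 = b) //; apply/ffunP=> v; rewrite ffunE inE subn0.
rewrite eqxx /bd big1 => [|k _]; first by rewrite eq_sym oner_eq0.
have [->|/Cy/andP[/andP[/forall_inP b0 /mb le] /eqP cF]] := eqVneq (y (k |: set0)) 0.
  by rewrite mulr0.
by move: le; rewrite -(sum_shift b0) cF; lia.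
Qed.

Lemma min_gen I : (exists b, I b) ->
  exists2 b, I b & forall c, I c -> (\sum_k b k <= \sum_k c k)%N.
Proof.
case=> b Ib; pose e m : bool :=
  if excluded_middle_informative (exists2 c, I c & \sum_k c k = m)%N then true else false.
have eP m : e m <-> (exists2 c, I c & \sum_k c k = m)%N.
  by rewrite /e; case: excluded_middle_informative.
have exe : exists m, e m by exists (\sum_k b k)%N; apply/eP; exists b.
case: (ex_minnP exe) => m /eP[c Ic cm] mc; exists c => // c' Ic'.
by rewrite cm; apply: mc; apply/eP; exists c'.
Qed.

(** [epsilon] is meaningful once the maximum exists: [stable] bounds the candidates, and a generator
    of least degree provides one. *)
Lemma reg_is_reg N I : upclosed I -> stable N I -> (exists b, I b) -> is_reg K I (reg K I).
Proof.
move=> up st ex; apply: epsilon_spec.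
(* Adding [n] turns degree minus [i] into a natural number, since [i <= n]. *)
pose D m := exists i b, betti K I i b <> 0%N /\ (m + i = \sum_k b k + n)%N.
pose d m : bool := if excluded_middle_informative (D m) then true else false.
have dP m : d m <-> D m by rewrite /d; case: excluded_middle_informative.
have leN i b : betti K I i b <> 0%N -> (i <= n /\ \sum_k b k <= n * N)%N.
  move/(betti_nzH K b up) => H; split.
    by have [F _ <-] := nzH_ex H; rewrite -[X in (_ <= X)%N]card_ord max_card.
  rewrite -[X in (_ <= X * _)%N]card_ord -sum_nat_const.
  by apply: leq_sum => k _; apply: nzH_koszul_le H k.
have exd : exists m, d m.
  have [c Ic mc] := min_gen ex.
  exists (\sum_k c k + n)%N; apply/dP; exists 0%N, c; rewrite addn0; split=> //.
  exact/(betti_nzH K c up)/nzH_min_gen.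
have bd_d m : d m -> (m <= n * N + n)%N.
  by move/dP=> [i [b [/leN [_ le] E]]]; lia.
case: (ex_maxnP exd bd_d) => m /dP[i [b [bt E]]] mx.
exists (Posz (\sum_k b k) - Posz i); split; last by exists i, b.
move=> i' b' bt'; have [li' lb'] := leN _ _ bt'; have [li lb] := leN _ _ bt.
have : d (\sum_k b' k + n - i')%N.
  by apply/dP; exists i', b'; split=> //; lia.
by move/mx; lia.
Qed.
End Regularity.

(** * Cohomology of flag complexes *)

Section Cohomology.
Local Open Scope ring_scope.
Variables (K : fieldType) (n : nat).
Implicit Types (F G T W U : {set 'I_n}) (Q D : pred {set 'I_n}).

(* Deleting a vertex of [F] adds one to [~: F], so complementation turns the
   boundary into a coboundary: [coH Q j] is the nonvanishing of the cohomology
   of [Q] at the faces of cardinality [j]. *)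
Definition coH Q j := exists2 i, (i + j = n)%N & nzH K (fun F => Q (~: F)) i.

Lemma coH_eq Q Q' j : Q =1 Q' -> coH Q j -> coH Q' j.
Proof. by move=> E [i ij H]; exists i => //; apply: nzH_eq H => F; apply: E. Qed.

Lemma coH_ex Q j : coH Q j -> exists2 G, Q G & #|G| = j.
Proof.
move=> [i ij /nzH_ex[F QF cF]]; exists (~: F) => //.
by have := cardsC F; rewrite card_ord; lia.
Qed.

Lemma coH_cone Q k j : (forall G, k \notin G -> Q (k |: G) = Q G) -> ~ coH Q j.
Proof.
move=> tQ [i _]; apply: (nzH_cone (k := k)) => F kF.
have k' : k \notin ~: (k |: F) by rewrite !inE eqxx.
rewrite -(tQ _ k'); congr (Q _); apply/setP=> v; rewrite !inE.
by have [->|] := eqVneq v k; rewrite ?kF.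
Qed.

Section Exact.
Variables (Q Q1 Q2 : pred {set 'I_n}).
Hypotheses (cQ : convex Q) (QE : forall G, Q G = Q1 G || Q2 G)
  (Q12 : forall G, Q1 G -> ~~ Q2 G)
  (uQ : forall F G, F \subset G -> Q1 F -> Q G -> Q1 G).

Let cQ' : convex (fun F => Q (~: F)).
Proof. by move=> F G H FG GH QF QH; apply: (cQ _ _ QH QF); rewrite setCS. Qed.
Let QE' F : Q (~: F) = Q1 (~: F) || Q2 (~: F). Proof. exact: QE. Qed.
Let Q12' F : Q1 (~: F) -> ~~ Q2 (~: F). Proof. exact: Q12. Qed.
Let uQ' F G : G \subset F -> Q1 (~: F) -> Q (~: G) -> Q1 (~: G).
Proof. by move=> GF; apply: uQ; rewrite setCS. Qed.

(** Complementation turns the upward closed part [Q1] into a subcomplex, so the three exactness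
    statements carry over, with connecting maps that raise the cardinality. *)
Lemma coH_split j : coH Q j -> coH Q1 j \/ coH Q2 j.
Proof. by move=> [i ij /(nzH_split cQ' QE' Q12' uQ')[]]; [left|right]; exists i. Qed.

Lemma coH_quot j : coH Q2 j -> coH Q j \/ coH Q1 j.+1.
Proof.
move=> [i ij /(nzH_quot cQ' QE' Q12' uQ')[H|[i' Ei H]]]; [left|right].
  by exists i.
by exists i' => //; lia.
Qed.

Lemma coH_sub j : coH Q1 j -> coH Q j \/ exists2 j', j = j'.+1 & coH Q2 j'.
Proof.
move=> [i ij /(nzH_sub cQ' QE' Q12' uQ')[H|H]]; [left|right]; first by exists i.
have [F _ cF] := nzH_ex H; have := max_card F; rewrite cF card_ord => lin.
by exists (n - i.+1)%N; [lia|exists i.+1 => //; lia].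
Qed.
End Exact.

Definition downclosed D := forall F G, G \subset F -> D F -> D G.

(** The case [u = v] asks for the vertices. The empty face is exempt so that the void complex counts
    as flag; it arises as a union of stars of non-vertices. *)
Definition flag D := downclosed D /\ forall F, F != set0 ->
  (forall u v, u \in F -> v \in F -> D [set u; v]) -> D F.

Definition restr D W := fun G => D G && (G \subset W).

Lemma down_convex D : downclosed D -> convex D.
Proof. by move=> dD F G H _ GH _; apply: dD. Qed.

Lemma restr_down D W : downclosed D -> downclosed (restr D W).
Proof.
by move=> dD F G GF /andP[DF FW]; rewrite /restr (dD _ _ GF) //= (subset_trans GF).
Qed.

Section Flag.
Variable D : pred {set 'I_n}.
Hypothesis fD : flag D.
Let dD : downclosed D := fD.1.

(** The star of [z] is thus the induced subcomplex on the vertices joined to [z], with [z]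
    itself. *)
Lemma flag_star z G : D [set z] -> D (z |: G) = D G && [forall v in G, D [set z; v]].
Proof.
move=> Dz; apply/idP/andP => [DG|[DG /forall_inP Dp]].
  split; first by apply: dD DG; rewrite subsetUr.
  apply/forall_inP => v vG; apply: dD DG; apply/subsetP => u.
  by rewrite !inE => /orP[->//|/eqP->]; rewrite vG orbT.
apply: fD.2 => [|u v]; first by apply/set0Pn; exists z; rewrite setU11.
rewrite !inE => /predU1P[->|uG] /predU1P[->|vG].
- by rewrite setUid.
- exact: Dp.
- by rewrite setUC Dp.
by apply: dD DG; apply/subsetP => t; rewrite !inE => /orP[]/eqP->.
Qed.

(** If [F] lies in neither star, some [u] in [F] is not joined to [x] and some [v] in [F] is not
    joined to [y]; the pair of [u] and [v] then lies in neither star. *)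
Lemma starU_flag x y : flag (fun G => D (x |: G) || D (y |: G)).
Proof.
have nolink z F : ~~ D (z |: F) -> D F -> F != set0 -> exists2 u, u \in F & ~~ D [set z; u].
  move=> ND DF /set0Pn[u uF]; have [Dz|ND1] := boolP (D [set z]).
    move: ND; rewrite flag_star // DF /= => /forallPn[v].
    by rewrite negb_imply => /andP[]; exists v.
  by exists u => //; apply: contra ND1; apply: dD; rewrite subsetUl.
split=> [F G GF /orP[]|F F0 pF].
- by move=> H; apply/orP; left; apply: dD H; rewrite setUS.
- by move=> H; apply/orP; right; apply: dD H; rewrite setUS.
have DF : D F by apply: fD.2 => // u v uF vF; case/orP: (pF u v uF vF);
  apply: dD; rewrite subsetUr.
apply/norP => -[/nolink/(_ DF F0)[u uF Nu] /nolink/(_ DF F0)[v vF Nv]].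
case/orP: (pF u v uF vF).
  by apply/negP; apply: contra Nu; apply: dD; rewrite setUA subsetUl.
by apply/negP; apply: contra Nv; apply: dD; rewrite (setUC [set u]) setUA subsetUl.
Qed.

Lemma coH_star z W j : coH (fun G => D (z |: G) && (G \subset W)) j ->
  exists W', coH (restr D W') j.
Proof.
move=> H; have [F /andP[DF _] _] := coH_ex H.
have Dz : D [set z] by apply: dD DF; rewrite subsetUl.
exists [set v in W | D [set z; v]]; apply: coH_eq H => G /=.
rewrite /restr flag_star // -andbA; congr (_ && _).
apply/andP/subsetP => [[/forall_inP DG /subsetP GW] v vG|sG].
  by rewrite inE GW //= DG.
by split; [apply/forall_inP=> v /sG|apply/subsetP=> v /sG]; rewrite inE => /andP[].
Qed.

(** The complex on [x], [y] and [U] is the suspension of the one on [U], glued from the cones with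
    apexes [x] and [y]. *)
Lemma coH_suspension x y U j : D [set x] -> D [set y] -> ~~ D [set x; y] ->
  (forall v, v \in U -> D [set x; v] && D [set y; v]) ->
  coH (restr D U) j -> coH (restr D (x |: (y |: U))) j.+1.
Proof.
move=> Dx Dy Dxy DU.
have xy : x != y by apply: contra Dxy => /eqP->; rewrite setUid.
have xU : x \notin U by apply: contra Dxy => /DU/andP[_]; rewrite setUC.
have yU : y \notin U by apply: contra Dxy => /DU/andP[].
have cone z W : D [set z] -> (forall v, v \in W -> D [set z; v]) ->
    forall G, z \notin G -> restr D (z |: W) (z |: G) = restr D (z |: W) G.
  move=> Dz DW G zG; rewrite /restr flag_star // -andbA; congr (_ && _).
  rewrite subUset sub1set setU11 /=; apply/andP/idP => [[]//|GW]; split=> //.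
  apply/forall_inP => v vG; apply: DW; have := subsetP GW v vG.
  by rewrite in_setU1 => /predU1P[E|//]; rewrite -E vG in zG.
(* The faces with [y] avoid [x]: they complete [U] to the cone of apex [y], and the cone of apex [x]
   to [S]. Both cones are acyclic, so the class passes through [S1]. *)
pose S := restr D (x |: (y |: U)); pose S1 := (fun G => S G && (y \in G)).
case/(@coH_quot (restr D (y |: U)) S1).
- exact/down_convex/restr_down.
- move=> G; rewrite /S1 /S /restr; have [DG|//] := boolP (D G) => /=.
  apply/idP/orP => [GU|[/andP[GU yG]|GU]].
  + have [yG|yG] := boolP (y \in G); [left|right].
      by rewrite andbT (subset_trans GU) // subsetUr.
    apply/subsetP => v vG; have := subsetP GU v vG.
    by rewrite in_setU1 => /predU1P[E|//]; rewrite -E vG in yG.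
  + apply/subsetP => v vG; have := subsetP GU v vG.
    rewrite in_setU1 => /predU1P[E|//]; case/negP: Dxy; apply: dD DG.
    by rewrite subUset !sub1set -E vG.
  by apply: subset_trans GU _; rewrite subsetUr.
- move=> G /andP[_ yG]; apply/negP => /andP[_ /subsetP/(_ _ yG)].
  by rewrite (negPf yU).
- move=> F G FG /andP[_ yF] /andP[DG GW]; rewrite /S1 /S /restr DG (subsetP FG) // andbT.
  by rewrite (subset_trans GW) // subsetUr.
- by move/coH_cone => /(_ y) []; apply: cone => // v /DU/andP[].
case/(@coH_sub S S1 (restr D (x |: U))) => //.
- exact/down_convex/restr_down.
- move=> G; rewrite /S1 /S /restr; have [DG|//] := boolP (D G) => /=.
  apply/idP/orP => [GU|[/andP[]//|GU]].
    have [yG|yG] := boolP (y \in G); [by left; rewrite GU|right].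
    apply/subsetP => v vG; have := subsetP GU v vG.
    by rewrite !inE => /orP[->//|/predU1P[E|->]]; [rewrite -E vG in yG|rewrite orbT].
  by apply: subset_trans GU _; rewrite setUS // subsetUr.
- move=> G /andP[_ yG]; apply/negP => /andP[_ /subsetP/(_ _ yG)].
  by rewrite !inE (negPf yU) eq_sym (negPf xy).
- by move=> F G FG /andP[_ yF] SG; rewrite /S1 SG (subsetP FG).
move=> [j' [<-]] /coH_cone => /(_ x) []; apply: cone => // v /DU/andP[] //.
Qed.

(** Mayer-Vietoris with pieces [X] and [Y] minus [X], the latter being [Y] relative to the
    intersection. A class of the intersection, one degree lower, is raised back by suspension over
    [x] and [y]. *)
Lemma coH_starU x y W j : ~~ D [set x; y] ->
  coH (restr (fun G => D (x |: G) || D (y |: G)) W) j ->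
  exists W', coH (restr D W') j.
Proof.
move=> Dxy; set S := restr _ _.
pose X G := D (x |: G) && (G \subset W); pose Y G := D (y |: G) && (G \subset W).
have dX z : downclosed (fun G => D (z |: G) && (G \subset W)).
  move=> F G GF /andP[DF FW]; rewrite (subset_trans GF) // andbT.
  by apply: dD DF; rewrite setUS.
have uX F G : F \subset G -> ~~ X F -> ~~ X G by move=> FG; apply: contra; apply: (dX x).
case/(@coH_split S (fun G => Y G && ~~ X G) X).
- exact/down_convex/restr_down/(starU_flag x y).1.
- move=> G; rewrite /S /restr /X /Y.
  by case: (D (x |: G)); case: (D (y |: G)); case: (G \subset W).
- by move=> G /andP[].
- move=> F G FG /andP[YF NX] SG; rewrite (uX _ _ FG NX); move: SG (uX _ _ FG NX).
  by rewrite /S /restr /X /Y andbT => /andP[/orP[]-> ->].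
- case/(@coH_sub Y _ (fun G => X G && Y G)).
  + exact/down_convex/(dX y).
  + by move=> G; case: (X G); case: (Y G).
  + by move=> G /andP[_ /negPf->].
  + by move=> F G FG /andP[_ NX] ->; rewrite (uX _ _ FG NX).
  + exact: coH_star.
  move=> [j' -> H]; have [F /andP[/andP[DxF _] /andP[DyF _]] _] := coH_ex H.
  have Dx : D [set x] by apply: dD DxF; rewrite subsetUl.
  have Dy : D [set y] by apply: dD DyF; rewrite subsetUl.
  pose U := [set v in W | D [set x; v] && D [set y; v]].
  exists (x |: (y |: U)); apply: coH_suspension => //.
    by move=> v; rewrite inE => /andP[].
  apply: coH_eq H => G; rewrite /X /Y /restr !flag_star //.
  have [DG|//] := boolP (D G) => /=; apply/idP/subsetP => [|GU].
    move=> /andP[/andP[/forall_inP Gx /subsetP GW] /andP[/forall_inP Gy _]] v vG.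
    by rewrite inE GW // Gx // Gy.
  have GW : G \subset W by apply/subsetP=> v /GU; rewrite inE => /andP[].
  rewrite GW !andbT; apply/andP; split; apply/forall_inP => v /GU;
    by rewrite inE => /and3P[].
exact: coH_star.
Qed.
End Flag.
End Cohomology.

(** * Regularity of the edge ideal *)

Section Hochster.
Local Open Scope ring_scope.
Variables (K : fieldType) (n : nat).
Implicit Types (F G T W U : {set 'I_n}) (P D : pred {set 'I_n}).

(** The faces of [P] and their enlargements by [t] form an acyclic cone, so the connecting map
    identifies the two homologies. *)
Lemma nzH_addv P t i : convex P -> (forall F, P F -> t \notin F) ->
  nzH K P i <-> nzH K (fun F => (t \in F) && P (F :\ t)) i.+1.
Proof.
move=> cP Pt; pose B := (fun F => P (F :\ t)); pose P2 F := (t \in F) && P (F :\ t).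
have acyc k : ~ nzH K B k.
  by apply: (nzH_cone (k := t)) => F tF; rewrite /B setU1K // setDE (setIidPl _) //
    subsetC sub1set inE.
have cB : convex B by move=> F G H FG GH; apply: cP; rewrite setSD.
have PB F : t \notin F -> F :\ t = F.
  by move=> tF; apply/setDidPl; rewrite disjoint_sym disjoints1.
have E1 F : B F = P F || P2 F.
  rewrite /B /P2; have [tF|tF] /= := boolP (t \in F); last by rewrite PB // orbF.
  by have [/Pt|] := boolP (P F); rewrite ?tF.
have E2 F : P F -> ~~ P2 F by move=> /Pt /negPf tF; rewrite /P2 tF.
have E3 F G : G \subset F -> P F -> B G -> P G.
  by move=> GF /Pt tF; rewrite /B PB //; apply: contra tF; apply: (subsetP GF).
split=> [/(nzH_sub cB E1 E2 E3)[/acyc[]|//]|].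
by move=> /(nzH_quot cB E1 E2 E3)[/acyc[]|[i' [->]]].
Qed.

(** [coH] takes complements in the full vertex set; adding the vertices outside [W] to every face
    relates them to complements in [W]. *)
Lemma nzH_addset P T i : convex P -> (forall F, P F -> [disjoint T & F]) ->
  nzH K P i <-> nzH K (fun F => (T \subset F) && P (F :\: T)) (i + #|T|)%N.
Proof.
have [m cT] := ubnP #|T|; elim: m => // m IH in P T i cT *.
have [->|/set0Pn[t tT]] := eqVneq T set0.
  by move=> _ _; rewrite cards0 addn0; split; apply: nzH_eq => F; rewrite setD0 sub0set.
move=> cP PT; have cT' : #|T| = #|T :\ t|.+1 by rewrite (cardsD1 t) tT.
have tP F : P F -> t \notin F by move=> /PT/disjointFr ->.
pose P' F := (t \in F) && P (F :\ t).
have cP' : convex P'.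
  move=> F G H FG GH /andP[tF PF] /andP[_ PH]; rewrite /P' (subsetP FG) //=.
  by apply: cP PF PH; rewrite setSD.
have dP' F : P' F -> [disjoint T :\ t & F].
  move=> /andP[_ /PT]; rewrite !disjoints_subset => /subsetP TF.
  by apply/subsetP => v /setD1P[vt /TF]; rewrite !inE vt.
rewrite (nzH_addv i cP tP) (IH P' (T :\ t) i.+1 _ cP' dP'); last by rewrite -cT' in cT *.
rewrite cT' addnS addSn.
have E F : (T :\ t \subset F) && P' (F :\: (T :\ t)) = (T \subset F) && P (F :\: T).
  rewrite /P' !inE eqxx /= setDDl setUC setD1K // andbA; congr (_ && _).
  by rewrite -{2}(setD1K tT) subUset sub1set andbC.
by split; apply: nzH_eq => F; rewrite E.
Qed.

Lemma nzH_coH D W i : downclosed D ->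
  nzH K (fun F => (F \subset W) && D (W :\: F)) i <->
  exists2 j, (i + j = #|W|)%N & coH K (restr D W) j.
Proof.
move=> dD; set P := fun F => _.
have cP : convex P.
  move=> F G H FG GH /andP[_ DF] /andP[HW _]; rewrite /P (subset_trans GH) //=.
  by apply: dD DF; rewrite setDS.
have dP F : P F -> [disjoint ~: W & F].
  by move=> /andP[FW _]; rewrite disjoint_sym disjoints_subset setCK.
have cW := cardsC W; rewrite card_ord in cW.
have E F : (~: W \subset F) && P (F :\: ~: W) = restr D W (~: F).
  rewrite /P /restr setDE setCK subsetIr /= andbC -setCS setCK.
  have [FW|] := boolP (~: F \subset W); rewrite ?andbF // !andbT; congr (D _).
  by rewrite setDIr setDv setU0 setDE (setIidPr FW).
rewrite (nzH_addset i cP dP); split=> [H|[j ij [i' ij' H]]].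
  exists (#|W| - i)%N; last exists (i + #|~: W|)%N.
  - have [F /andP[_ _] cF] := nzH_ex H; move: H => /nzH_ex[F' /andP[_ /andP[FW _]] cF'].
    by have := subset_leq_card FW; have := cardsD F' (~: W);
       have := subset_leq_card (subsetIr F' (~: W)); lia.
  - have [F /andP[WF /andP[FW _]] cF] := nzH_ex H.
    by have := subset_leq_card FW; rewrite cardsD (setIidPr WF); lia.
  by apply: nzH_eq H => F; apply: E.
have -> : (i + #|~: W| = i')%N by lia.
by apply: nzH_eq H => F; rewrite -E.
Qed.

Definition indep (e : rel 'I_n) : pred {set 'I_n} :=
  fun G => [forall i in G, forall j in G, ~~ e i j].

Definition sqfree W : mono n := [ffun v => (v \in W : nat)].

Lemma sum_sqfree W : (\sum_v sqfree W v = #|W|)%N.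
Proof.
by rewrite -sum1_card [RHS]big_mkcond; apply: eq_bigr => v _; rewrite ffunE; case: (v \in W).
Qed.

Lemma edge_ideal_up e : upclosed (@edge_ideal n e).
Proof.
move=> b c bc /existsP[i /existsP[j /and3P[ij bi bj]]].
by apply/existsP; exists i; apply/existsP; exists j; rewrite ij !(leq_trans _ (bc _)).
Qed.

Lemma edge_ideal_stable e : stable 1 (@edge_ideal n e).
Proof.
move=> b k bk /existsP[i /existsP[j /and3P[ij bi bj]]].
have S v : (0 < b v -> 0 < shift b [set k] v)%N.
  by rewrite ffunE inE; have [->|_] := eqVneq v k; rewrite ?subn0 ?subn_gt0.
by apply/existsP; exists i; apply/existsP; exists j; rewrite ij !S.
Qed.

Lemma le_reg (I : monideal n) (b : mono n) i : upclosed I -> is_reg K I (reg K I) ->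
  nzH K (koszul I b) i -> (Posz (\sum_k b k) - Posz i <= reg K I).
Proof. by move=> up [H _] /(betti_nzH K b up)/H. Qed.

Lemma indep_flag (e : rel 'I_n) : flag (indep e).
Proof.
split=> [F G /subsetP GF /forall_inP iF|F _ pF].
  apply/forall_inP => u /GF/iF/forall_inP iu.
  by apply/forall_inP => v /GF/iu.
apply/forall_inP => u uF; apply/forall_inP => v vF.
have /forall_inP/(_ u) := pF u v uF vF; rewrite !inE eqxx => /(_ isT)/forall_inP/(_ v).
by rewrite !inE eqxx orbT; apply.
Qed.

Lemma koszul_sqfree (e : rel 'I_n) W F :
  koszul (edge_ideal e) (sqfree W) F = (F \subset W) && ~~ indep e (W :\: F).
Proof.
rewrite /koszul; congr (_ && _).
  by apply/forall_inP/subsetP => FW k /FW; rewrite ffunE lt0b.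
have E i : (0 < shift (sqfree W) F i)%N = (i \in W :\: F).
  by rewrite !ffunE inE; case: (i \in F); case: (i \in W).
apply/existsP/idP => [[i /existsP[j]]|].
  rewrite !E => /and3P[ij iWF jWF]; apply/negP => /forall_inP/(_ _ iWF)/forall_inP/(_ _ jWF).
  by rewrite ij.
move=> /forall_inPn[i iWF /forall_inPn[j jWF]]; rewrite negbK => ij.
by exists i; apply/existsP; exists j; rewrite !E ij iWF.
Qed.

(** One half of Hochster's formula: the simplex on [W] is acyclic, and the connecting map takes the
    class of the quotient by the ideal to homological degree [#|W| - j - 1] of the ideal, in total
    degree [#|W|]. *)
Lemma reg_edge_ideal_ge (e : rel 'I_n) W j : (exists x y, e x y) ->
  coH K (restr (indep e) W) j -> (Posz j.+1 <= reg K (edge_ideal e)).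
Proof.
move=> [x [y exy]] H; have up := @edge_ideal_up e.
have exI : exists b, edge_ideal e b.
  exists [ffun=> 1%N]; apply/existsP; exists x; apply/existsP; exists y.
  by rewrite exy !ffunE.
have isr := reg_is_reg K up (@edge_ideal_stable e) exI.
(* The simplex on no vertices is not acyclic; here [j = 0], and a generator of least degree
   suffices. *)
have [W0|/set0Pn[w wW]] := eqVneq W set0.
  have [G /andP[_]] := coH_ex H; rewrite W0 subset0 => /eqP -> /esym; rewrite cards0 => ->.
  have [b Ib /(nzH_min_gen K Ib) /(le_reg up isr)] := min_gen exI.
  have /existsP[i /existsP[_ /and3P[_ bi _]]] := Ib.
  by rewrite (bigD1 i) //=; lia.
have jW : (j <= #|W|)%N.
  by have [G /andP[_ /subset_leq_card le] <-] := coH_ex H.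
have [_ /(_ (ex_intro2 _ _ j _ H))] := nzH_coH W (#|W| - j) (indep_flag e).1.
move=> /(_ (subnK jW)) NB.
have cF : convex (fun F => F \subset W).
  by move=> F G G' _ GG' _; apply: subset_trans.
have up' := koszul_down (b := sqfree W) up.
case: (@nzH_quot K n (fun F => F \subset W) (koszul (edge_ideal e) (sqfree W))
  _ cF _ _ _ _ NB).
- move=> F; rewrite koszul_sqfree; case: (F \subset W) => //=.
  by rewrite orNb.
- by move=> F; rewrite koszul_sqfree => /andP[-> ].
- by move=> F G GF /(up' _ _ GF).
- move=> /(nzH_cone (k := w)) []; move=> F wF.
  by rewrite subUset sub1set wW.
move=> [i' Ei /(le_reg up isr)]; rewrite sum_sqfree; lia.
Qed.
End Hochster.

(** * Exchange for transport matrices *)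

Section Exchange.
Variable n : nat.

Lemma sum_lt_exists (f g : 'I_n -> nat) :
  \sum_v f v < \sum_v g v -> exists v, f v < g v.
Proof.
move=> lt; have [/existsP//|/existsPn N] := boolP [exists v, f v < g v].
by move: lt; rewrite ltnNge leq_sum // => v _; rewrite leqNgt N.
Qed.

Lemma sum_eqb (F : 'I_n -> nat) i : \sum_v F v * (v == i) = F i.
Proof.
rewrite (bigD1 i) //= eqxx muln1 big1 ?addn0 // => v /negPf->; exact: muln0.
Qed.

(* Exchange property of transversal polymatroids: walk along an alternating
   path of the difference of the two transport matrices [f] and [g], starting
   in column [i], until a column where [f] exceeds [g]. *)
Lemma transport_exchange (f g : 'I_n -> 'I_n -> nat) i :
  (forall p, \sum_q f p q = \sum_q g p q) -> \sum_p f p i < \sum_p g p i ->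
  exists i' h, [/\ \sum_p g p i' < \sum_p f p i',
    forall p, \sum_q h p q = \sum_q f p q,
    forall p q, 0 < h p q -> (0 < f p q) || (0 < g p q) &
    forall v, \sum_p h p v + (v == i') = \sum_p f p v + (v == i)].
Proof.
(* Each step of the path lowers the total excess of [g] over [f]. *)
have [m] := ubnP (\sum_p \sum_q (g p q - f p q)).
elim: m => // m IH in f i *; move=> ltm rows lti.
have [p ltp] := sum_lt_exists lti.
have [q ltq] : exists q, g p q < f p q.
  have := rows p; rewrite (bigD1 i) //= [RHS](bigD1 i) //= => E.
  have [|q] := @sum_lt_exists (fun q => g p q * (q != i)) (fun q => f p q * (q != i)).
    rewrite (bigD1 i) //= [X in _ < X](bigD1 i) //= eqxx !muln0 !add0n.
    rewrite (eq_bigr (g p)) => [|j /negPf->]; last by rewrite muln1.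
    rewrite [X in _ < X](eq_bigr (f p)) => [|j /negPf->]; last by rewrite muln1.
    by lia.
  by case: (q != i); rewrite ?muln0 // !muln1; exists q.
have qi : q != i by apply/eqP => E; move: ltq ltp; rewrite E; lia.
(* One unit of row [p] moves from column [q] to column [i]; the subtraction is exact because [f p q]
   is positive. *)
pose f1 a b := f a b + (a == p) * (b == i) - (a == p) * (b == q).
have f1E a b : f1 a b + (a == p) * (b == q) = f a b + (a == p) * (b == i).
  rewrite subnK //; have [->|_] := eqVneq a p; last by [].
  by have [->|_] := eqVneq b q; [rewrite (negPf qi); lia|].
have rows1 a : \sum_b f1 a b = \sum_b f a b.
  apply/eqP; rewrite -(eqn_add2r (\sum_b (a == p) * (b == q))) -big_split /=.
  rewrite (eq_bigr _ (fun b _ => f1E a b)) big_split /= eqn_add2l.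
  by rewrite !(sum_eqb (fun=> (a == p : nat))).
have cols1 v : \sum_a f1 a v + (v == q) = \sum_a f a v + (v == i).
  have S w : \sum_a (a == p) * (v == w) = (v == w).
    under eq_bigr => a _ do rewrite mulnC.
    exact: (sum_eqb (fun=> (v == w : nat))).
  rewrite -{1}(S q) -(S i) -!big_split /=.
  by apply: eq_bigr => a _; apply: f1E.
have pos1 a b : 0 < f1 a b -> (0 < f a b) || (0 < g a b).
  have [f0|] := posnP (f a b); last by [].
  rewrite /f1 f0; have [->|_] := eqVneq a p; last by [].
  by have [->|_] := eqVneq b i; [rewrite (leq_ltn_trans _ ltp)|].
have [ltq1|leq1] := ltnP (\sum_a g a q) (\sum_a f a q); first by exists q, f1.
(* Column [q] of [f1] has now dropped below that of [g], and the path goes on from [q]. *)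
have [|a||i' [h [lti' rowsh posh colsh]]] := IH f1 q.
- rewrite -ltnS; apply: leq_trans ltm; rewrite ltnS (bigD1 p) //= [X in _ < X](bigD1 p) //=.
  rewrite -addSn leq_add //; last first.
    by apply: leq_sum => a /negPf ap; apply: leq_sum => b _; rewrite /f1 ap; lia.
  rewrite (bigD1 i) //= [X in _ < X](bigD1 i) //= -addSn leq_add //.
    by rewrite /f1 !eqxx eq_sym (negPf qi); lia.
  apply: leq_sum => b /negPf bi; rewrite /f1 bi eqxx.
  by have [->|_] := eqVneq b q; lia.
- by rewrite rows1 rows.
- by have := cols1 q; rewrite eqxx (negPf qi); lia.
exists i', h; split=> [|a|a b /posh|v].
- move: (cols1 i') lti'; have [->|_] := eqVneq i' i; last by lia.
  by rewrite eq_sym (negPf qi); lia.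
- by rewrite rowsh.
- by case/orP=> [/pos1//|->]; rewrite orbT.
by rewrite colsh cols1.
Qed.

(** Lexicographic order, smallest index first, read as a number in base [B]; it is faithful on
    vectors of total degree below [B]. *)
Definition lexw B (m : 'I_n -> nat) := \sum_v m v * B ^ (n - v).

(** The entries of [m] after [i] total less than [B], so they cannot make up one unit at the place
    of [i]. *)
Lemma lexw_lt B (m m' : 'I_n -> nat) (i : 'I_n) : \sum_v m v < B ->
  (forall j : 'I_n, j < i -> m j = m' j) -> m i < m' i -> lexw B m < lexw B m'.
Proof.
move=> mB ji lt; rewrite /lexw (bigID (fun j : 'I_n => j < i)).
rewrite [X in _ < X](bigID (fun j : 'I_n => j < i)) /=.
rewrite (eq_bigr (fun j : 'I_n => m' j * B ^ (n - j))) => [|j /ji->//].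
rewrite ltn_add2l (bigD1 i) ?ltnn //= [X in _ < X](bigD1 i) ?ltnn //=.
have B0 : 0 < B by apply: leq_ltn_trans mB.
have L : \sum_(j < n | ~~ (j < i) && (j != i)) m j * B ^ (n - j) < B ^ (n - i).
  have -> : n - i = (n - i.+1).+1 by rewrite subnSK.
  rewrite expnS; apply: leq_ltn_trans (_ : (\sum_j m j) * B ^ (n - i.+1) < _); last first.
    by rewrite ltn_pmul2r // expn_gt0 B0.
  rewrite big_distrl /= big_mkcond /=; apply: leq_sum => j _; case: ifP => // /andP[ij ji'].
  rewrite leq_mul2l leq_pexp2l ?orbT // leq_sub2l //.
  by rewrite ltn_neqAle eq_sym ji' leqNgt.
have : m i * B ^ (n - i) + B ^ (n - i) <= m' i * B ^ (n - i).
  by rewrite -mulSnr leq_mul2r lt orbT.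
move=> /leq_trans H; apply: leq_trans (H _ (leq_addr _ _)).
by rewrite ltn_add2l.
Qed.

Lemma lexw_first_diff B (m m' : 'I_n -> nat) :
  \sum_v m v < B -> \sum_v m' v < B -> lexw B m <= lexw B m' ->
  m =1 m' \/ exists2 i : 'I_n, m i < m' i & forall j : 'I_n, j < i -> m j = m' j.
Proof.
move=> mB mB' le; have [/forallP E|/forallPn[i0 Ni0]] := boolP [forall j, m j == m' j].
  by left=> j; apply/eqP.
right; have [i Ni mi] := @arg_minnP _ i0 (fun j => m j != m' j) val Ni0.
have ji (j : 'I_n) : j < i -> m j = m' j.
  by move=> lt; apply/eqP; apply: contraTT lt => /mi; rewrite -leqNgt.
exists i => //; move: Ni; rewrite neq_ltn => /orP[//|lt].
by have := lexw_lt mB' (fun j lt_ji => esym (ji j lt_ji)) lt; rewrite ltnNge le.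
Qed.
End Exchange.

(** * Products of edges *)

Section EdgeLists.
Variables (n : nat) (e : rel 'I_n).
Implicit Types (es : seq ('I_n * 'I_n)) (b m w : mono n) (C G T : {set 'I_n}).

Definition dg es (v : 'I_n) : nat := \sum_(p <- es) ((p.1 == v) + (p.2 == v)).

Definition edges es := all (fun p => e p.1 p.2) es.

Definition expand (c : 'I_n * 'I_n -> nat) : seq ('I_n * 'I_n) :=
  flatten [seq nseq (c p) p | p <- enum {: 'I_n * 'I_n}].

Lemma big_expand c (F : 'I_n * 'I_n -> nat) : \sum_(p <- expand c) F p = \sum_p c p * F p.
Proof.
rewrite big_flatten /= big_map -[RHS]big_enum; apply: eq_bigr => p _.
by rewrite big_nseq iter_addn_0 mulnC.
Qed.

Lemma mem_expand c p : p \in expand c -> 0 < c p.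
Proof.
by move=> /flattenP[_ /mapP[q _ ->]]; rewrite mem_nseq => /andP[cq /eqP->].
Qed.

Lemma big_count_mem es (F : 'I_n * 'I_n -> nat) :
  \sum_(p <- es) F p = \sum_p count_mem p es * F p.
Proof.
elim: es => [|p es IH]; first by rewrite big_nil big1.
rewrite big_cons IH /= (eq_bigr _ (fun q _ => mulnDl _ _ _)) big_split /=; congr (_ + _).
rewrite (bigD1 p) //= eqxx mul1n big1 ?addn0 // => q /negPf.
by rewrite eq_sym => ->.
Qed.

Lemma size_sum1 es : size es = \sum_(p <- es) 1.
Proof. by rewrite sum1_size. Qed.

Lemma powP s b : edge_ideal_pow e s b <->
  exists es, [/\ size es = s, edges es & forall v, dg es v <= b v].
Proof.
split=> [/existsP[c /and3P[/eqP cs /forallP ce /forallP cb]]|[es [ss ees eb]]].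
  exists (expand (fun p => c p)); split.
  - by rewrite size_sum1 big_expand -[RHS]cs; apply: eq_bigr => p _; rewrite muln1.
  - by apply/allP => p /mem_expand; apply/implyP.
  by move=> v; rewrite /dg big_expand.
have lc p : count_mem p es < s.+1 by rewrite ltnS -ss count_size.
apply/existsP; exists [ffun p => Ordinal (lc p)]; apply/and3P; split.
- rewrite -[X in _ == X]ss size_sum1 big_count_mem; apply/eqP/eq_bigr => p _.
  by rewrite ffunE muln1.
- apply/forallP => p; apply/implyP; rewrite ffunE /= -has_count => /hasP[q qes /eqP <-].
  exact: (allP ees).
apply/forallP => v; apply: leq_trans (eb v); rewrite /dg big_count_mem.
by apply/eq_leq/eq_bigr => p _; rewrite ffunE.
Qed.

Lemma sum_dg (C : {set 'I_n}) es :
  \sum_(v in C) dg es v = \sum_(p <- es) ((p.1 \in C) + (p.2 \in C)).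
Proof.
rewrite /dg exchange_big /=; apply: eq_bigr => p _.
have S x : \sum_(v in C) (x == v) = (x \in C).
  have [xC|xC] := boolP (x \in C).
    by rewrite (bigD1 x) //= eqxx big1 // => v /andP[_ /negPf]; rewrite eq_sym => ->.
  by apply: big1 => v vC; case: eqP => // E; rewrite E vC in xC.
by rewrite big_split /= !S.
Qed.

Lemma sum_dgT es : \sum_v dg es v = (size es).*2.
Proof.
have := sum_dg setT es; rewrite (eq_bigl xpredT) => [->|v]; last by rewrite inE.
rewrite -muln2 size_sum1 big_distrl /=; apply: eq_bigr => p _.
by rewrite !inE.
Qed.

Lemma vertex_coverP C : reflect (forall i j, e i j -> (i \in C) || (j \in C)) (vertex_cover e C).
Proof.
apply: (iffP forallP) => [H i j ij|H i]; first by have /forallP/(_ j)/implyP/(_ ij) := H i.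
by apply/forallP => j; apply/implyP/H.
Qed.

Lemma indep_coverP G : vertex_cover e (~: G) = indep e G.
Proof.
apply/vertex_coverP/forall_inP => [H i iG|H i j ij].
  apply/forall_inP => j jG; apply/negP => /H.
  by rewrite !inE iG jG.
rewrite !inE -negb_and; apply: contraL ij => /andP[iG jG].
by have /forall_inP := H i iG; apply.
Qed.

Lemma min_cover_sub C : vertex_cover e C ->
  exists2 D : {set 'I_n}, D \subset C & min_vertex_cover e D.
Proof.
move=> /minset_exists[D /minsetP[vD mD] DC]; exists D => //; rewrite /min_vertex_cover vD /=.
apply/forallP => D'; apply/implyP => /properP[sD [x xD xD']]; apply/negP => vD'.
by move: xD'; rewrite (mD _ vD' sD) xD.
Qed.

Lemma symb_powP s b : symb_pow e s b <->
  forall C, vertex_cover e C -> s <= \sum_(v in C) b v.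
Proof.
split=> [/forallP H C /min_cover_sub[D DC mD]|H].
  have /implyP/(_ mD) := H D => /leq_trans; apply.
  rewrite [X in _ <= X](big_setID D) /= (setIidPr DC); exact: leq_addr.
by apply/forallP => C; apply/implyP => /andP[/H].
Qed.

Lemma cover_edges C es : vertex_cover e C -> edges es ->
  size es <= \sum_(v in C) dg es v.
Proof.
move=> /vertex_coverP vC /allP ees; rewrite sum_dg size_sum1 big_seq [X in _ <= X]big_seq.
by apply: leq_sum => p /ees/vC; case: (p.1 \in C); case: (p.2 \in C).
Qed.

(** Each edge contributes at least one to the degree on a cover, so degree [size es] allows no edge
    with both ends in [C]. *)
Lemma tight_edges C es : vertex_cover e C -> edges es ->
  \sum_(v in C) dg es v <= size es ->
  all (fun p => (p.1 \in C) != (p.2 \in C)) es.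
Proof.
move=> vC; elim: es => //= p es IH /andP[ep ees].
have Hp : 0 < (p.1 \in C) + (p.2 \in C).
  by move/vertex_coverP: vC => /(_ _ _ ep); case: (p.1 \in C); case: (p.2 \in C).
have := cover_edges vC ees; rewrite !sum_dg in IH *; rewrite big_cons => le le'.
have : (p.1 \in C) + (p.2 \in C) <= 1.
  by rewrite -(leq_add2r (size es)) add1n; apply: leq_trans le'; rewrite leq_add2l.
rewrite IH //; last first.
  by rewrite -ltnS; apply: leq_trans le'; rewrite -add1n leq_add2r.
by rewrite andbT; move: Hp; case: (p.1 \in C); case: (p.2 \in C).
Qed.

(* The Stanley-Reisner complex of [(I^(s+1) : m)], [m] the product of the [s]
   edges [es]; see [symb_pow_colon]. *)
Definition colon_complex es : pred {set 'I_n} :=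
  foldr (fun p (D : pred {set 'I_n}) G => D (p.1 |: G) || D (p.2 |: G)) (indep e) es.

Lemma colon_complex_flag es : flag (colon_complex es).
Proof. by elim: es => [|p es IH]; [apply: indep_flag|apply: starU_flag]. Qed.

Lemma colon_complexP es G : colon_complex es G <->
  exists2 T : {set 'I_n}, G \subset T & indep e T && all (fun p => (p.1 \in T) || (p.2 \in T)) es.
Proof.
elim: es G => [|p es IH] G /=.
  split=> [iG|[T GT /andP[iT _]]]; first by exists G; rewrite ?iG.
  exact: (indep_flag e).1 GT iT.
split=> [/orP[]/IH[T GT /andP[iT aT]]|[T GT /and3P[iT pT aT]]].
- move: GT; rewrite subUset sub1set => /andP[pT GT].
  by exists T; rewrite // iT pT.
- move: GT; rewrite subUset sub1set => /andP[pT GT].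
  by exists T; rewrite // iT pT orbT.
case/orP: pT => pT; apply/orP; [left|right]; apply/IH; exists T;
  by rewrite ?iT // subUset sub1set pT.
Qed.

Lemma colon_complex_indep es G : colon_complex es G -> indep e G.
Proof. by move=> /colon_complexP[T GT /andP[iT _]]; apply: (indep_flag e).1 GT iT. Qed.

(** Faces stay independent at every stage, so the ends of the next edge never span a face and
    [coH_starU] removes the edges one at a time. *)
Lemma coH_colon_complex (K : fieldType) es W j : edges es -> coH K (restr (colon_complex es) W) j ->
  exists W', coH K (restr (indep e) W') j.
Proof.
elim: es W => [|p es IH] W /=; first by exists W.
move=> /andP[ep ees] H.
have [|W' H'] := @coH_starU K n (colon_complex es) (colon_complex_flag es) p.1 p.2 W j _ H.
  apply/negP => /colon_complex_indep/forall_inP/(_ p.1).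
  rewrite !inE eqxx => /(_ isT)/forall_inP/(_ p.2).
  by rewrite !inE eqxx orbT ep => /(_ isT).
exact: IH H'.
Qed.

(** [C] is the complement of the independent set [T], which meets every edge of [es] exactly when no
    edge has both ends in [C]. *)
Lemma colon_complex_coverP es G : edges es -> colon_complex es G <->
  exists C, [/\ vertex_cover e C, [disjoint G & C] & \sum_(v in C) dg es v <= size es].
Proof.
move=> ees; split=> [/colon_complexP[T GT /andP[iT /allP aT]]|[C [vC dG le]]].
  exists (~: T); rewrite indep_coverP; split=> //; first by rewrite disjoints_subset setCK.
  rewrite sum_dg size_sum1 big_seq [X in _ <= X]big_seq; apply: leq_sum => p /aT.
  by rewrite !inE; case: (p.1 \in T); case: (p.2 \in T).
apply/colon_complexP; exists (~: C); first by rewrite -disjoints_subset.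
rewrite -indep_coverP setCK vC /=; apply: sub_all (tight_edges vC ees le) => p.
by rewrite !inE; case: (p.1 \in C); case: (p.2 \in C).
Qed.

Definition supp (b : 'I_n -> nat) : {set 'I_n} := [set v | 0 < b v].

(** A cover on which [w] has degree at most [size es] is already filled by the product, so [w] and
    [dg es] agree there and the cofactor avoids the cover. *)
Lemma symb_pow_colon es w : edges es -> (forall v, dg es v <= w v) ->
  symb_pow e (size es).+1 w = ~~ colon_complex es (supp (fun v => w v - dg es v)).
Proof.
move=> ees le; apply/idP/idP.
  move/symb_powP=> sw; apply/negP => /(colon_complex_coverP _ ees)[C [vC dC tC]].
  have := sw C vC; rewrite leqNgt => /negP[]; rewrite ltnS; apply: leq_trans tC.
  apply: leq_sum => v vC'; have := disjointFl dC vC'; rewrite inE subn_gt0.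
  by move/negbT; rewrite -leqNgt.
move=> nl; apply/symb_powP => C vC; rewrite ltnNge; apply: contra nl => tw.
apply/(colon_complex_coverP _ ees); exists C; split=> //.
  rewrite disjoint_sym disjoints_subset; apply/subsetP => v vC'.
  rewrite !inE -leqNgt leqn0 subn_eq0.
  have := cover_edges vC ees; rewrite (bigD1 v) //=.
  have : \sum_(i in C | i != v) dg es i <= \sum_(i in C | i != v) w i by apply: leq_sum.
  by move: tw; rewrite (bigD1 v) //=; lia.
by apply: leq_trans tw; apply: leq_sum.
Qed.
End EdgeLists.

(** * Linear quotients *)

Section LinearQuotients.
Variables (n : nat) (e : rel 'I_n).
Hypothesis e_sym : symmetric e.
Implicit Types (es : seq ('I_n * 'I_n)) (w : mono n) (C : {set 'I_n}).

Lemma orient_edges C es : edges e es ->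
  all (fun p => (p.1 \in C) != (p.2 \in C)) es ->
  exists es', [/\ edges e es', size es' = size es, dg es' =1 dg es &
    all (fun p => (p.1 \in C) && (p.2 \notin C)) es'].
Proof.
elim: es => [|p es IH] /=; first by exists [::].
move=> /andP[ep ees] /andP[pC aC]; have [es' [ees' ses' des' aes']] := IH ees aC.
have [p1|p1] := boolP (p.1 \in C).
  exists (p :: es'); split=> /=; rewrite ?ep ?ses' ?aes' //.
    by move=> v; rewrite /dg !big_cons; congr (_ + _); apply: des'.
  by rewrite p1 andbT; move: pC; rewrite p1; case: (p.2 \in C).
exists ((p.2, p.1) :: es'); split=> /=; rewrite ?ses' ?aes' //.
- by rewrite e_sym ep.
- by move=> v; rewrite /dg !big_cons /= [X in X + _ = _]addnC; congr (_ + _); apply: des'.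
by rewrite p1 andbT; move: pC; rewrite (negPf p1); case: (p.2 \in C).
Qed.

Definition transport es (a b : 'I_n) := count_mem (a, b) es.

Lemma transport_row es a : \sum_b transport es a b = \sum_(p <- es) (p.1 == a).
Proof.
elim: es => [|[x y] es IH]; first by rewrite big_nil big1.
rewrite big_cons -IH /transport /= big_split /=; congr (_ + _).
rewrite (bigD1 y) //= !xpair_eqE eqxx andbT big1 ?addn0 // => b /negPf by_.
by rewrite xpair_eqE eq_sym [y == b]eq_sym by_ andbF.
Qed.

Lemma transport_col es b : \sum_a transport es a b = \sum_(p <- es) (p.2 == b).
Proof.
elim: es => [|[x y] es IH]; first by rewrite big_nil big1.
rewrite big_cons -IH /transport /= big_split /=; congr (_ + _).
rewrite (bigD1 x) //= !xpair_eqE eqxx big1 ?addn0 // => a /negPf by_.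
by rewrite xpair_eqE [x == a]eq_sym by_.
Qed.

Lemma dg_transport es v : dg es v = \sum_b transport es v b + \sum_a transport es a v.
Proof. by rewrite transport_row transport_col -big_split. Qed.

Lemma sum_neq0 (I : eqType) (r : seq I) (F : I -> bool) : 0 < \sum_(i <- r) F i -> has F r.
Proof.
by apply: contraTT => /hasPn N; rewrite big_seq big1 // => i /N /negPf->.
Qed.

(** Both products agree with [w] on the cover [C]. With edges oriented out of [C] they become
    transport matrices with equal row sums, whose column sums are the exponents off [C]. *)
Lemma exchange_edges C es es' w i : vertex_cover e C ->
  edges e es -> edges e es' -> size es' = size es ->
  (forall v, dg es v <= w v) -> (forall v, dg es' v <= w v) ->
  \sum_(v in C) w v <= size es -> dg es i < dg es' i ->
  exists i' es'', [/\ dg es' i' < dg es i', edges e es'', size es'' = size es &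
    forall v, dg es'' v + (v == i') = dg es v + (v == i)].
Proof.
move=> vC ees ees' ss le le' tw lti.
have tight fs : edges e fs -> size fs = size es -> (forall v, dg fs v <= w v) ->
    exists gs, [/\ edges e gs, size gs = size es, dg gs =1 dg fs &
      all (fun p => (p.1 \in C) && (p.2 \notin C)) gs] /\ {in C, dg fs =1 w}.
  move=> efs sfs lefs; have tfs : \sum_(v in C) dg fs v <= size fs.
    by rewrite sfs; apply: leq_trans tw; apply: leq_sum.
  have [gs [egs sgs dgs ags]] := orient_edges efs (tight_edges vC efs tfs).
  exists gs; split; first by split; rewrite // sgs.
  move=> v vinC; apply/eqP; rewrite eqn_leq lefs /=.
  have := cover_edges vC efs; rewrite (bigD1 v) //= sfs.
  have : \sum_(i in C | i != v) dg fs i <= \sum_(i in C | i != v) w i by apply: leq_sum.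
  by move: tw; rewrite (bigD1 v) //=; lia.
have [gs [[egs sgs dgs ags] wgs]] := tight es ees erefl le.
have [gs' [[egs' sgs' dgs' ags'] wgs']] := tight es' ees' ss le'.
have iC : i \notin C by apply: contraL lti => iC; rewrite wgs // wgs' // ltnn.
pose f := transport gs; pose g := transport gs'.
have row0 hs : all (fun p => (p.1 \in C) && (p.2 \notin C)) hs ->
    forall v, v \notin C -> \sum_b transport hs v b = 0.
  move=> /allP ah v vC'; apply/eqP; rewrite transport_row -leqn0 leqNgt; apply/negP.
  by move=> /sum_neq0/hasP[p /ah/andP[p1 _] /eqP E]; rewrite E (negPf vC') in p1.
have col0 hs : all (fun p => (p.1 \in C) && (p.2 \notin C)) hs ->
    forall v, v \in C -> \sum_a transport hs a v = 0.
  move=> /allP ah v vC'; apply/eqP; rewrite transport_col -leqn0 leqNgt; apply/negP.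
  by move=> /sum_neq0/hasP[p /ah/andP[_ p2] /eqP E]; rewrite E vC' in p2.
have colE v : v \notin C -> \sum_a f a v = dg es v /\ \sum_a g a v = dg es' v.
  by move=> vC'; rewrite -dgs -dgs' !dg_transport (row0 gs) ?(row0 gs').
have rows p : \sum_q f p q = \sum_q g p q.
  have [pC|pC] := boolP (p \in C); last by rewrite (row0 gs) // (row0 gs').
  have := wgs p pC; rewrite -(wgs' p pC) -dgs -dgs' !dg_transport (col0 gs) // (col0 gs') //.
  by rewrite !addn0.
have [i0E i1E] := colE i iC.
have [|i' [h [lti' rowsh posh colsh]]] := @transport_exchange n f g i rows.
  by rewrite i0E i1E.
have i'C : i' \notin C.
  by apply: contraL lti' => /(col0 gs ags); rewrite /f => ->.
have [i'E i'E'] := colE i' i'C.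
exists i', (expand (fun p => h p.1 p.2)).
have SE (F : 'I_n * 'I_n -> nat) :
    \sum_(p <- expand (fun p => h p.1 p.2)) F p = \sum_a \sum_b h a b * F (a, b).
  by rewrite big_expand pair_big /=; apply: eq_bigr => -[a b] _.
have dgh v : dg (expand (fun p => h p.1 p.2)) v = \sum_b h v b + \sum_a h a v.
  rewrite /dg SE (eq_bigr _ (fun a _ => eq_bigr _ (fun b _ => mulnDr _ _ _))).
  rewrite (eq_bigr _ (fun a _ => big_split _ _ _ _ _)) big_split /=; congr (_ + _).
    rewrite (bigD1 v) //= eqxx [X in _ + X]big1 ?addn0 => [|a /negPf->].
      by apply: eq_bigr => b _; rewrite muln1.
    by apply: big1 => b _; rewrite muln0.
  by apply: eq_bigr => a _; rewrite sum_eqb.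
split.
- by rewrite -i'E -i'E'.
- apply/allP => p /mem_expand/posh /orP[]; rewrite /f /g /transport -has_count;
    move=> /hasP[q qin /eqP E].
    by have := allP egs q qin; rewrite E.
  by have := allP egs' q qin; rewrite E.
- rewrite size_sum1 SE; transitivity (\sum_a \sum_b f a b).
    by apply: eq_bigr => a _; rewrite -rowsh; apply: eq_bigr => b _; rewrite muln1.
  rewrite (eq_bigr _ (fun a _ => transport_row gs a)) exchange_big /= -[RHS]sgs size_sum1.
  by apply: eq_bigr => p _; rewrite (bigD1 p.1) //= eqxx big1 // => a /negPf; rewrite eq_sym => ->.
move=> v; rewrite dgh -dgs dg_transport rowsh -!addnA; congr (_ + _); exact: colsh.
Qed.

(** At the first index [i] where the exponents differ, an exchange trades some variable [i'] for
    [i]. As [es'] has the smaller exponent at [i'], this index comes after [i], and the new product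
    is larger. *)
Lemma linear_quotient es es' w : edges e es -> edges e es' -> size es' = size es ->
  (forall v, dg es v <= w v) -> (forall v, dg es' v <= w v) ->
  ~~ symb_pow e (size es).+1 w ->
  lexw (size es).*2.+1 (dg es) < lexw (size es).*2.+1 (dg es') ->
  exists v es'', [/\ dg es v < w v, edges e es'', size es'' = size es,
    lexw (size es).*2.+1 (dg es) < lexw (size es).*2.+1 (dg es'') &
    forall u, dg es'' u <= dg es u + (u == v)].
Proof.
move=> ees ees' ss le le' NS lt.
have [C [vC tw]] : exists C, vertex_cover e C /\ \sum_(v in C) w v <= size es.
  apply: NNPP => N; case/negP: NS; apply/symb_powP => C vC.
  by rewrite ltnNge; apply/negP => tw; apply: N; exists C.
have [||E|[i lti ji]] := @lexw_first_diff n (size es).*2.+1 (dg es) (dg es') _ _ (ltnW lt).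
- by rewrite sum_dgT.
- by rewrite sum_dgT ss.
- by move: lt; rewrite /lexw (eq_bigr _ (fun v _ => congr1 (muln^~ _) (E v))) ltnn.
have [i' [es'' [lti' ees'' ses'' des'']]] := exchange_edges vC ees ees' ss le le' tw lti.
have ii' : i < i'.
  rewrite ltnNge leq_eqVlt; apply/negP => /orP[/eqP/val_inj E|/ji E].
    by move: lti'; rewrite E ltnNge ltnW.
  by move: lti'; rewrite E ltnn.
exists i, es''; split=> //.
- exact: leq_trans lti (le' i).
- apply: (@lexw_lt n _ _ _ i); first by rewrite sum_dgT.
    move=> j ltj; have := des'' j; rewrite -!val_eqE /= (ltn_eqF ltj).
    by rewrite (ltn_eqF (ltn_trans ltj ii')); lia.
  by have := des'' i; rewrite eqxx -val_eqE /= (ltn_eqF ii'); lia.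
by move=> u; rewrite -des'' leq_addr.
Qed.
End LinearQuotients.

(** * Koenig duality and odd cycles *)

Section Koenig.
Variables (n : nat) (r : rel 'I_n) (X : {set 'I_n}).
Hypotheses (r_sym : symmetric r) (rX : forall i j, r i j -> (i \in X) != (j \in X)).

Lemma sum_subn1 (b : 'I_n -> nat) x (C : {set 'I_n}) : 0 < b x ->
  \sum_(v in C) (b v - (v == x)) + (x \in C) = \sum_(v in C) b v.
Proof.
move=> bx; have [xC|xC] := boolP (x \in C).
  rewrite (bigD1 x) //= [RHS](bigD1 x) //= eqxx addnAC subnK //; congr (_ + _).
  by apply: eq_bigr => v /andP[_ /negPf->]; rewrite subn0.
rewrite addn0; apply: eq_bigr => v vC; case: eqP => [E|_]; last by rewrite subn0.
by rewrite -E vC in xC.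
Qed.

(** Uncrossing: every edge joins [X] to its complement. The combination here and that of
    [vertex_cover_cup_cap] have together the weight of [C] and [D]. *)
Lemma vertex_cover_cap_cup C D : vertex_cover r C -> vertex_cover r D ->
  vertex_cover r (X :&: (C :&: D) :|: ~: X :&: (C :|: D)).
Proof.
move=> /vertex_coverP vC /vertex_coverP vD; apply/vertex_coverP => i j ij.
have := rX ij; have := vC i j ij; have := vD i j ij; rewrite !inE.
by case: (i \in C); case: (j \in C); case: (i \in D); case: (j \in D);
  case: (i \in X); case: (j \in X).
Qed.

Lemma vertex_cover_cup_cap C D : vertex_cover r C -> vertex_cover r D ->
  vertex_cover r (X :&: (C :|: D) :|: ~: X :&: (C :&: D)).
Proof.
move=> /vertex_coverP vC /vertex_coverP vD; apply/vertex_coverP => i j ij.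
have := rX ij; have := vC i j ij; have := vD i j ij; rewrite !inE.
by case: (i \in C); case: (j \in C); case: (i \in D); case: (j \in D);
  case: (i \in X); case: (j \in X).
Qed.

(* Covers of minimal weight [s] form a lattice, so among those containing [x]
   there is one, [C], with largest trace on the side opposite to [X]; a
   neighbour [y] of [x] outside [C] then lies in no minimal-weight cover
   containing [x], and the edge [xy] can be split off. *)
Lemma koenig s (b : 'I_n -> nat) :
  (forall C, vertex_cover r C -> s <= \sum_(v in C) b v) ->
  exists es, [/\ size es = s, edges r es & forall v, dg es v <= b v].
Proof.
have [N] := ubnP (\sum_v b v); elim: N => // N IH in s b *; rewrite ltnS => bN.
case: s => [|s] cov; first by exists [::]; split=> // v; rewrite /dg big_nil.
have vX : vertex_cover r X.
  by apply/vertex_coverP => i j /rX; case: (i \in X); case: (j \in X).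
have [x xX bx] : exists2 x, x \in X & 0 < b x.
  have [/exists_inP//|/exists_inPn NX] := boolP [exists x in X, 0 < b x].
  have := cov X vX; rewrite big1 // => v /NX; rewrite -leqNgt leqn0 => /eqP//.
have sumT (c : 'I_n -> nat) : \sum_(v in [set: 'I_n]) c v = \sum_v c v.
  by apply: eq_bigl => v; rewrite inE.
pose tight C := [&& vertex_cover r C, x \in C & \sum_(v in C) b v == s.+1].
have [/existsP[C1 tC1]|/existsPn NT] := boolP [exists C, tight C]; last first.
  have [||es [ss ees les]] := IH s.+1 (fun v => b v - (v == x)).
  - apply: leq_trans bN; rewrite -!sumT -(sum_subn1 setT bx) inE addn1 ltnS.
    exact: leqnn.
  - move=> C vC; have E := sum_subn1 C bx; case xC: (x \in C) E => E; last first.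
      by rewrite -(addn0 (\sum_(_ in _) _)) E; apply: cov.
    have := NT C; rewrite /tight vC xC /= => ne.
    by rewrite -ltnS -[X in _ < X]addn1 E ltn_neqAle eq_sym ne cov.
  by exists es; split=> // v; apply: leq_trans (les v) (leq_subr _ _).
have [C /and3P[vC xC /eqP tC] mC] := @arg_maxnP _ C1 tight (fun C => #|C :\: X|) tC1.
(* Otherwise [C] without [x] would be a cover of weight below [s.+1]. *)
have [y xy yC] : exists2 y, r x y & y \notin C.
  apply: NNPP => N0; have xN y : r x y -> y \in C.
    by move=> xy; apply: contraT => yC; case: N0; exists y.
  have /cov : vertex_cover r (C :\ x).
    apply/vertex_coverP => i j ij; rewrite !inE.
    have := rX ij; have [E|ix] /= := eqVneq i x.
      rewrite E in ij *; rewrite (xN j ij) andbT; apply: contra => /eqP->; exact: eqxx.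
    have [E|jx] /= := eqVneq j x; last by move=> _; have /vertex_coverP := vC; apply.
    by move=> _; rewrite orbF; apply: xN; rewrite r_sym -E.
  by rewrite leqNgt => /negP[]; rewrite -tC [X in _ < X](big_setD1 x) //= -add1n leq_add2r.
have yX : y \notin X by move: (rX xy); rewrite xX; case: (y \in X).
have maxY D : tight D -> C :\: X \subset D -> y \in D -> False.
  move=> tD sCD yD; have : #|D :\: X| <= #|C :\: X| := mC D tD.
  rewrite leqNgt => /negP[]; apply: proper_card.
  apply/properP; split; last by exists y; rewrite !inE yX ?yD // (negPf yC).
  by apply/subsetP => v /[dup] vCX /setDP[_ vX']; rewrite inE vX' (subsetP sCD).
(* A weightless [y] could be added to [C], against maximality off [X]. *)
have by0 : 0 < b y.
  rewrite lt0n; apply/eqP => by0; apply: (maxY (y |: C)); rewrite ?setU11 //; last first.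
    by apply/subsetP => v; rewrite !inE => /andP[_ ->]; rewrite orbT.
  rewrite /tight in_setU1 xC orbT big_setU1 //= by0 add0n tC eqxx andbT.
  apply/vertex_coverP => i j; have /vertex_coverP H := vC.
  by move=> /H; rewrite !inE => /orP[]->; rewrite !orbT.
have no_tight D : vertex_cover r D -> x \in D -> y \in D -> s.+1 < \sum_(v in D) b v.
  move=> vD xD yD; rewrite ltn_neqAle cov // andbT; apply/eqP => tD.
  have vM := vertex_cover_cap_cup vC vD; have vM' := vertex_cover_cup_cap vC vD.
  have E : \sum_(v in X :&: (C :&: D) :|: ~: X :&: (C :|: D)) b v +
      \sum_(v in X :&: (C :|: D) :|: ~: X :&: (C :&: D)) b v = s.+1 + s.+1.
    rewrite -{1}tC tD ![\sum_(_ in _) _]big_mkcond -!big_split /=; apply: eq_bigr => v _.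
    by rewrite !inE; case: (v \in X); case: (v \in C); case: (v \in D);
      rewrite /= ?addn0 ?add0n.
  apply: (maxY (X :&: (C :&: D) :|: ~: X :&: (C :|: D))).
  - rewrite /tight vM !inE xX xC xD /=; have := cov _ vM; have := cov _ vM'; move: E.
    by set p := \sum_(_ in _) _; set q := \sum_(_ in _) _ => E; rewrite eqn_leq => le le' ;
      rewrite le' andbT -(leq_add2r q) E leq_add2l.
  - by apply/subsetP => v; rewrite !inE => /andP[-> ->]; rewrite orbT.
  by rewrite !inE yX yD !orbT.
have xy' : y != x by apply: contra yX => /eqP->.
have b1y : 0 < b y - (y == x) by rewrite (negPf xy') subn0.
(* A cover with both ends loses two units but had one to spare by [no_tight]; any other cover loses
   one. *)
pose b2 v := b v - (v == x) - (v == y).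
have b2E (D : {set 'I_n}) : \sum_(v in D) b2 v + (x \in D) + (y \in D) = \sum_(v in D) b v.
  by rewrite addnAC -(sum_subn1 D bx) -(@sum_subn1 (fun v => b v - (v == x)) y D b1y).
have [||es [ss ees les]] := IH s b2.
- apply: leq_trans bN; rewrite -!sumT -(b2E setT) !inE -addnA addn2.
  exact: leqnSn.
- move=> D vD; rewrite -(leq_add2r ((x \in D) + (y \in D))) [X in _ <= X]addnA b2E.
  have := cov D vD; have := no_tight D vD.
  by case: (x \in D); case: (y \in D) => //=; rewrite ?addn1 ?addn0 ?addn2;
    [move/(_ isT isT) | | |move=> _ /ltnW].
exists ((x, y) :: es); split=> [|/=|v]; [by rewrite /= ss|by rewrite /edges /= xy|].
have le : (x == v) + (y == v) <= b v.
  have [<-|_] := eqVneq x v; first by rewrite (negPf xy') addn0.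
  by have [<-|] := eqVneq y v.
rewrite /dg big_cons -[X in _ <= X](subnKC le) leq_add2l subnDA.
by have := les v; rewrite /b2 [v == x]eq_sym [v == y]eq_sym.
Qed.
End Koenig.

Section OddCycles.
Variables (n : nat) (r : rel 'I_n).
Hypothesis r_sym : symmetric r.

Lemma closed_path_cycle x p : path r x p -> last x p = x -> p != [::] ->
  exists2 c, cycle r c & size c = size p.
Proof.
case/lastP: p => // p y; rewrite last_rcons => pth E _; rewrite E in pth.
by exists (x :: p); rewrite // size_rcons.
Qed.

(** [X] collects the vertices reached by an even walk from the root of their component; [cycle]
    allows repeated vertices, so an edge inside [X] closes an odd one. *)
Lemma even_cycles_bipartite : (forall c, cycle r c -> ~~ odd (size c)) ->
  exists X : {set 'I_n}, forall i j, r i j -> (i \in X) != (j \in X).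
Proof.
move=> even_c; have csym : connect_sym r by apply: sym_connect_sym.
pose W v := exists p,
  [/\ path r (fingraph.root r v) p, last (fingraph.root r v) p = v & ~~ odd (size p)].
pose w v : bool := if excluded_middle_informative (W v) then true else false.
have wP v : w v <-> W v by rewrite /w; case: excluded_middle_informative.
exists [set v | w v] => i j ij; rewrite !inE.
have Eij : fingraph.root r i = fingraph.root r j by apply/eqP; rewrite root_connect // connect1.
have [wi|wi] := boolP (w i); have [wj|wj] := boolP (w j) => //; exfalso.
  have [p [pp lp ep]] := (wP i).1 wi; have [q [pq lq eq]] := (wP j).1 wj.
  rewrite -Eij in pq lq; pose c := p ++ j :: rev (belast (fingraph.root r i) q).
  have pc : path r (fingraph.root r i) c.
    rewrite cat_path pp lp /= ij -{1}lq rev_path.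
    by rewrite -(eq_path (e := r)) // => u v; rewrite r_sym.
  have lc : last (fingraph.root r i) c = fingraph.root r i.
    rewrite last_cat /=; case: (q) lq => [|u q'] /= lq; first by rewrite -lq.
    by rewrite rev_cons last_rcons.
  have [|d cd sd] := closed_path_cycle pc lc; first by rewrite /c; case: (p).
  have := even_c d cd; rewrite sd size_cat /= size_rev size_belast addnS /= oddD.
  by rewrite (negPf ep) (negPf eq).
have /connectP[p pp lp] : connect r (fingraph.root r i) i by rewrite csym connect_root.
case/negP: wj; apply/wP; exists (rcons p j); rewrite -Eij rcons_path last_rcons pp -lp ij.
split=> //; rewrite size_rcons /= negbK; apply: contraR wi => ep; apply/wP.
by exists p.
Qed.

Lemma not_uniq_split (T : eqType) (p : seq T) : ~~ uniq p ->
  exists x p1 p2 p3, p = p1 ++ x :: p2 ++ x :: p3.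
Proof.
elim: p => //= a p IH; rewrite negb_and negbK => /orP[ap|/IH[x [p1 [p2 [p3 ->]]]]].
  by case/splitPr: ap => p1 p2; exists a, [::], p1, p2.
by exists x, (a :: p1), p2, p3.
Qed.

(** A repeated vertex cuts a closed walk into two shorter ones, one of which is odd. *)
Lemma odd_cycle_uniq c : cycle r c -> odd (size c) ->
  exists d, [/\ cycle r d, uniq d, odd (size d) & size d <= size c].
Proof.
have [m] := ubnP (size c); elim: m => // m IH in c *; rewrite ltnS => cm cc oc.
have [uc|/not_uniq_split[x [p1 [p2 [p3 E]]]]] := boolP (uniq c); first by exists c.
move: cc oc cm; rewrite E -(rot_cycle (size p1)) rot_size_cat -(size_rot (size p1)) rot_size_cat.
rewrite /= -catA /= rcons_cat cat_path /= => /and3P[pp2 lx pp3].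
rewrite !size_cat /= => oc cm.
have [o2|e2] := boolP (odd (size p2).+1).
  have [|||d [cd ud od sd]] := IH (x :: p2) => //=.
  + by lia.
  + by rewrite rcons_path pp2.
  by exists d; split=> //; move: sd => /=; lia.
have [|||d [cd ud od sd]] := IH (x :: (p3 ++ p1)) => //.
- by move: cm => /=; lia.
- by move: oc e2; rewrite /= addnS /= oddD; case: (odd (size p2)); case: odd.
by exists d; split=> //; move: sd => /=; lia.
Qed.

Lemma path_cycle_nth x0 (c : seq 'I_n) i j : cycle r c -> i < j -> j < size c ->
  r (nth x0 c i) (nth x0 c j) -> exists2 d, cycle r d & size d = (j - i).+1.
Proof.
move=> cc ij jc rij; pose d := take (j - i).+1 (drop i c).
have sd : size d = (j - i).+1 by rewrite size_takel // size_drop; lia.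
exists d => //; have nd k : k <= j - i -> nth x0 d k = nth x0 c (i + k).
  by move=> kd; rewrite nth_take ?ltnS // nth_drop.
have sord : sorted r d.
  apply/take_sorted/drop_sorted; case: (c) cc => //= a c'; rewrite rcons_path.
  by case/andP.
have d0 := nd 0 isT; have dl := nd (j - i) (leqnn _).
rewrite addn0 in d0; rewrite subnKC ?(ltnW ij) // in dl.
case: d sd {nd} sord d0 dl => //= a d [sd] pd a0 dl.
rewrite rcons_path pd; suff -> : last a d = nth x0 c j by rewrite a0 r_sym.
by rewrite -dl -sd (last_nth x0).
Qed.
End OddCycles.

(** * The symbolic power inside the ordinary power *)

Section SymbolicInPower.
Variables (n : nat) (e : rel 'I_n).
Hypotheses (e_sym : symmetric e) (e_irr : irreflexive e).

(** Every other edge of a path; a last unpaired vertex is dropped. *)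
Fixpoint pairup (p : seq 'I_n) : seq ('I_n * 'I_n) :=
  if p is x :: y :: q then (x, y) :: pairup q else [::].

Lemma pair_ind (Q : seq 'I_n -> Prop) : Q [::] -> (forall x, Q [:: x]) ->
  (forall x y q, Q q -> Q [:: x, y & q]) -> forall p, Q p.
Proof.
move=> Q0 Q1 Q2; suff H p : Q p /\ forall x, Q (x :: p) by move=> p; case: (H p).
by elim: p => [|x p [IH1 IH2]]; split=> // y; apply: Q2.
Qed.

Lemma size_pairup p : size (pairup p) = (size p)./2.
Proof. by elim/pair_ind: p => //= x y q ->. Qed.

Lemma dg_cons p (es : seq ('I_n * 'I_n)) v : dg (p :: es) v = (p.1 == v) + (p.2 == v) + dg es v.
Proof. by rewrite /dg big_cons. Qed.

Lemma dg_pairup p v : dg (pairup p) v <= count_mem v p.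
Proof.
elim/pair_ind: p => [|x|x y q IH]; rewrite /= ?dg_cons /=; [by rewrite /dg big_nil..|].
by rewrite addnA leq_add2l.
Qed.

Lemma edges_pairup p : sorted e p -> edges e (pairup p).
Proof.
elim/pair_ind: p => //= x y q IH /andP[xy yq]; rewrite /edges /= xy; apply: IH.
exact: path_sorted yq.
Qed.

Lemma pow_ge s es (b : mono n) : edges e es -> s <= size es ->
  (forall v, dg es v <= b v) -> edge_ideal_pow e s b.
Proof.
move=> ees les le; apply/powP; exists (take s es); split.
- by rewrite size_takel.
- by apply/allP => p /mem_take; apply: (allP ees).
move=> v; apply: leq_trans (le v); rewrite -[X in _ <= dg X v](cat_take_drop s es).
by rewrite /dg big_cat leq_addr.
Qed.

(** With [k = s - 1]: a chord between odd positions of a cycle of length 2s-1 closes an odd cycle of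
    length at most 2s-3. *)
Lemma odd_gap k i j : odd i -> odd j -> i < j -> j < k.*2.+1 ->
  odd (j - i).+1 /\ (j - i).+1 + 3 <= 2 * k.+1.
Proof.
move=> oi oj ij jk; split; first by rewrite /= oddB ?(ltnW ij) // oi oj.
have i0 : 0 < i by case: (i) oi.
have : j != k.*2 by apply: contraL oj => /eqP->; rewrite odd_double.
by clear oi oj; lia.
Qed.

(** On the support of [b] the graph is bipartite, and Koenig duality yields [s.+1] edges, or it has
    an odd cycle of length at least 2s-1. Beyond 2s-1 the cycle alone contains [s] disjoint
    edges. *)
Lemma symb_sub_pow s (b : mono n) : (1 <= s)%N ->
  (forall l, odd l -> l + 3 <= 2 * s -> ~ has_cycle_of_length e l) ->
  symb_pow e s.+1 b -> edge_ideal_pow e s b.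
Proof.
move=> s1 hcyc /symb_powP sb.
pose r : rel 'I_n := fun i j => [&& e i j, 0 < b i & 0 < b j].
have r_sym : symmetric r by move=> i j; rewrite /r e_sym [X in _ && X]andbC.
have re i j : r i j -> e i j by case/and3P.
have no_odd c : cycle e c -> odd (size c) -> 2 * s < size c + 3.
  move=> cc oc; rewrite ltnNge; apply/negP => le.
  have [d [cd ud od sd]] := odd_cycle_uniq cc oc.
  apply: (hcyc (size d)) => //; first by lia.
  exists d; split=> //; case: (d) cd od => [|x [|y [|z d']]] //=.
  by rewrite e_irr.
have [even_r|] := classic (forall c, cycle r c -> ~~ odd (size c)).
  have [X rX] := even_cycles_bipartite r_sym even_r.
  have [C vC|es [ss ees les]] := koenig r_sym rX (s := s.+1) (b := b).
    (* Variables absent from [b] complete a cover of [r] to one of [e] at no cost. *)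
    have /sb : vertex_cover e (C :|: [set v | b v == 0]).
      apply/vertex_coverP => i j ij; rewrite !inE.
      have := vC; move/vertex_coverP => /(_ i j); rewrite /r ij !lt0n.
      by case: (b i == 0); case: (b j == 0); rewrite ?orbT //= ?orbF; apply.
    move/leq_trans; apply; rewrite [X in X <= _]big_mkcond [X in _ <= X]big_mkcond.
    apply: leq_sum => v _; rewrite !inE.
    by case: (v \in C) => //=; case: eqP => // ->.
  apply: (pow_ge (es := es)) => //; last by rewrite ss.
  by apply: sub_all ees => p /re.
move=> /not_all_ex_not[c Nc]; have [cr /negP] := imply_to_and _ _ Nc; rewrite negbK => oc.
have [p [pr up op _]] := odd_cycle_uniq cr oc.
have pe : cycle e p by apply: sub_cycle pr => i j /re.
have lp := no_odd p pe op.
have pb v : v \in p -> 0 < b v.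
  by move=> vp; have := next_cycle pr vp; case/and3P.
have cnt v : count_mem v p = (v \in p) by rewrite count_uniq_mem.
have sp : sorted e p by case: (p) pe => //= x q; rewrite rcons_path => /andP[].
have dp v : dg (pairup p) v <= (v \in p) by rewrite -cnt dg_pairup.
have [ls|ls] := leqP s (size p)./2.
  apply: (pow_ge (edges_pairup sp)); rewrite ?size_pairup // => v.
  by apply: leq_trans (dp v) _; have := pb v; case: (v \in p) => // ->.
have E2 : size p = (s.-1).*2.+1 by lia.
pose z v := b v - (v \in p).
have bz v : b v = (v \in p) + z v.
  by rewrite subnKC //; have := pb v; case: (v \in p) => // ->.
have sE : s.-1.+1 = s by lia.
(* If a leftover variable is joined to [v] on the cycle, the other 2s-2 cycle vertices form a path
   and pair up. *)
have [N1|N1] := classic (exists u v, [/\ e u v, 0 < z u & v \in p]).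
  have [u [v [uv zu vp]]] := N1; have [k q Eq] := rot_to vp.
  have /= pathq : path e v (rcons q v) by rewrite -/(cycle e (v :: q)) -Eq rot_cycle.
  have sq : sorted e q by move: pathq; rewrite rcons_path => /andP[/path_sorted].
  apply: (pow_ge (es := (u, v) :: pairup q)).
  - by rewrite /edges /= uv; apply: edges_pairup.
  - have : size (v :: q) = size p by rewrite -Eq size_rot.
    by rewrite /= size_pairup E2 => -[->]; rewrite doubleK sE.
  move=> w; rewrite dg_cons /= bz -(mem_rot k) Eq.
  have -> : (w \in v :: q) = count_mem w (v :: q) :> nat.
    by rewrite count_uniq_mem // -Eq rot_uniq.
  rewrite /= -[X in _ <= X]addnA addnAC addnC leq_add2l addnC leq_add ?dg_pairup //.
  by have [<-|] := eqVneq u w.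
have [N2|N2] := classic (exists u v, [/\ e u v, 0 < z u & 0 < z v]).
  have [u [v [uv zu zv]]] := N2.
  apply: (pow_ge (es := (u, v) :: pairup p)).
  - by rewrite /edges /= uv; apply: edges_pairup.
  - by rewrite /= size_pairup E2 /= uphalf_double sE.
  move=> w; rewrite dg_cons /= bz addnC leq_add //.
  have [<-|_] := eqVneq u w; last by have [<-|] := eqVneq v w.
  by case: eqP => // E; rewrite E e_irr in uv.
(* The odd positions give [s-1] vertices, independent by [odd_gap]. *)
pose A := [set v in p | odd (index v p)].
have [x0 x0p] : exists x0, x0 \in p by case: (p) op => // x q _; exists x; rewrite mem_head.
have cA : s.-1 <= #|A|.
  have inj : injective (fun i : 'I_(s.-1) => nth x0 p i.*2.+1).
    move=> i j /eqP; rewrite nth_uniq ?E2 //; first by move=> /eqP[] /double_inj/val_inj.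
    - by rewrite ltnS ltn_double.
    by rewrite ltnS ltn_double.
  rewrite -[X in X <= _]card_ord -(card_imset _ inj); apply/subset_leq_card/subsetP.
  move=> _ /imsetP[i _ ->]; have li : i.*2.+1 < size p by rewrite E2 ltnS ltn_double.
  by rewrite inE mem_nth //= index_uniq //= odd_double.
have indA u v : u \in A -> v \in A -> index u p < index v p -> ~~ e u v.
  rewrite !inE => /andP[up' ou] /andP[vp ov] lt; apply/negP => uv.
  have [||d cd sd] := @path_cycle_nth _ e e_sym x0 p _ _ pe lt; rewrite ?index_mem ?nth_index //.
  have ltv : index v p < (s.-1).*2.+1 by rewrite -E2 index_mem.
  have [o3 le3] := odd_gap ou ov lt ltv.
  by have := no_odd d cd; rewrite sd => /(_ o3); rewrite ltnNge -{1}sE le3.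
pose T := [set v | 0 < z v] :|: A.
have iT : indep e T.
  apply/forall_inP => u uT; apply/forall_inP => v vT; apply/negP => uv.
  have Ap w : w \in A -> w \in p by rewrite inE => /andP[].
  move: uT vT; rewrite !in_setU.
  case/orP => [zu|uA]; case/orP => [zv|vA].
  - by apply: N2; exists u, v; split=> //; [move: zu|move: zv]; rewrite inE.
  - by apply: N1; exists u, v; split=> //; [move: zu; rewrite inE|apply: Ap].
  - by apply: N1; exists v, u; rewrite e_sym; split=> //; [move: zv; rewrite inE|apply: Ap].
  have [lt|lt|E] := ltngtP (index u p) (index v p).
  - by have := indA u v uA vA lt; rewrite uv.
  - by have := indA v u vA uA lt; rewrite e_sym uv.
  have Euv : u = v by rewrite -(nth_index x0 (Ap u uA)) E nth_index // Ap.
  by rewrite Euv e_irr in uv.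
have := sb (~: T); rewrite indep_coverP => /(_ iT).
(* Off [T] only cycle vertices outside [A] occur in [b], with exponent 1, so the degree is at most
   (2s-1) - (s-1) = s. *)
suff : \sum_(v in ~: T) b v <= #|[set v in p] :\: A|.
  have := cardsD [set v in p] A; rewrite (setIidPr _); last first.
    by apply/subsetP => v; rewrite /A !inE => /andP[].
  have -> : #|[set v in p]| = size p by rewrite cardsE; apply/card_uniqP.
  rewrite E2 => -> le1 le2; move: s1 cA (leq_trans le2 le1); rewrite -addnn.
  by clear; lia.
rewrite -sum1_card [X in X <= _]big_mkcond [X in _ <= X]big_mkcond; apply: leq_sum => v _.
rewrite /T /A !inE bz; case: (posnP (z v)) => [->|] //=; rewrite addn0.
by case: (v \in p) => //=; case: odd.
Qed.
End SymbolicInPower.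

(** * The regularity bound *)

Section RegularityBound.
Variables (K : fieldType) (n : nat).
Implicit Types (F G W : {set 'I_n}) (b w : mono n).

(** Since [c] grows as faces shrink, the fibre of the top value is a subcomplex; fibres are split
    off from the top until one carries homology. *)
Lemma nzH_fibers (P : pred {set 'I_n}) (c : {set 'I_n} -> nat) i : convex P ->
  (forall F G, G \subset F -> P F -> P G -> c F <= c G) ->
  nzH K P i -> exists k, nzH K (fun F => P F && (c F == k)) i.
Proof.
move=> cP anti.
have H m : nzH K (fun F => P F && (c F < m)) i -> exists k, nzH K (fun F => P F && (c F == k)) i.
  elim: m => [/nzH_ex[F]|m IH]; first by rewrite andbF.
  case/(@nzH_split K n _ (fun F => P F && (c F == m)) (fun F => P F && (c F < m))).
  - move=> F G H' FG GH /andP[PF cF] /andP[PH _]; have PG := cP _ _ _ FG GH PF PH.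
    by rewrite PG; apply: leq_ltn_trans cF; apply: anti.
  - by move=> F; rewrite -andb_orr ltnS leq_eqVlt.
  - by move=> F /andP[-> /eqP ->]; rewrite ltnn.
  - move=> F G GF /andP[PF /eqP cF] /andP[PG cG]; rewrite PG eqn_leq -ltnS cG -cF.
    exact: anti.
  - by move=> H; exists m.
  exact: IH.
move=> HP; apply: (H (\max_F c F).+1); apply: nzH_eq HP => F.
by rewrite ltnS (leq_bigmax F) andbT.
Qed.

Variable e : rel 'I_n.
Hypothesis e_sym : symmetric e.

Lemma pow_up s : upclosed (@edge_ideal_pow n e s).
Proof.
move=> b c bc /powP[es [ss ees le]]; apply/powP; exists es; split=> // v.
exact: leq_trans (le v) (bc v).
Qed.

Lemma pow_stable s : stable s.*2 (@edge_ideal_pow n e s).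
Proof.
move=> b k bk /powP[es [ss ees le]]; apply/powP; exists es; split=> // v.
rewrite ffunE inE; have [->|_] := eqVneq v k; last by rewrite subn0.
rewrite subn1 -ltnS prednK ?(leq_ltn_trans _ bk) //.
by rewrite -ss -sum_dgT (bigD1 k) //= leq_addr.
Qed.

Lemma symb_up s : upclosed (@symb_pow n e s).
Proof.
move=> b c bc /symb_powP sb; apply/symb_powP => C vC; apply: leq_trans (sb C vC) _.
by apply: leq_sum.
Qed.

Lemma symb_stable s : stable s (@symb_pow n e s).
Proof.
move=> b k bk /symb_powP sb; apply/symb_powP => C vC.
have [kC|kC] := boolP (k \in C).
  rewrite (bigD1 k) //= ffunE inE eqxx subn1; apply: leq_trans (leq_addr _ _).
  by rewrite -ltnS prednK // (leq_ltn_trans _ bk).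
apply: leq_trans (sb C vC) _; apply: leq_sum => v vC'; rewrite ffunE inE.
by case: eqP => [E|_]; [rewrite -E vC' in kC|rewrite subn0].
Qed.

Lemma lexw_inj B (m m' : 'I_n -> nat) : \sum_v m v < B -> \sum_v m' v < B ->
  lexw B m = lexw B m' -> m =1 m'.
Proof.
move=> mB mB' E; have [//|[i lt ji]] := lexw_first_diff mB mB' (eq_leq E).
by have := lexw_lt mB ji lt; rewrite E ltnn.
Qed.

Section QuotientBound.
Variables (s : nat) (b : mono n) (i : nat).
Let B := s.*2.+1.
Let divides (t : s.-tuple ('I_n * 'I_n)) (w : 'I_n -> nat) :=
  edges e t && [forall v, dg t v <= w v].

Let lead F := \max_(t in [set t : s.-tuple ('I_n * 'I_n) | divides t (shift b F)]) lexw B (dg t).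

Let P F := koszul (edge_ideal_pow e s) b F && ~~ symb_pow e s.+1 (shift b F).

Let lead_attained F : P F ->
  exists2 t : s.-tuple ('I_n * 'I_n), divides t (shift b F) & lead F = lexw B (dg t).
Proof.
move=> /andP[/andP[_ /powP[es [ss ees les]]] _].
have : 0 < #|[set t : s.-tuple ('I_n * 'I_n) | divides t (shift b F)]|.
  apply/card_gt0P; exists (Tuple (introT eqP ss)); rewrite inE /divides /= ees.
  exact/forallP.
by case/(eq_bigmax_cond (fun t : s.-tuple ('I_n * 'I_n) => lexw B (dg t))) => t;
  rewrite inE; exists t.
Qed.

Let lead_ge F t : divides t (shift b F) -> lexw B (dg t) <= lead F.
Proof. by move=> dt; rewrite /lead (bigD1 t) ?inE //= leq_maxl. Qed.

Let dgB (t : s.-tuple ('I_n * 'I_n)) : \sum_v dg t v < B.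
Proof. by rewrite sum_dgT size_tuple. Qed.

Lemma koszul_quotient_bound : (exists x y, e x y) -> nzH K P i ->
  (Posz (\sum_v b v) - Posz i + 1 <= reg K (edge_ideal e) + Posz (2 * s))%R.
Proof.
move=> exE HP.
have cP : convex P.
  move=> F G H FG GH /andP[_ NF] /andP[LH _]; apply/andP; split.
    exact: (koszul_down (@pow_up s) GH LH).
  by apply: contra NF; apply: symb_up; apply: shift_anti.
have [|k Hk] := nzH_fibers (c := lead) cP _ HP.
  move=> F G GF PF PG; have [t /andP[et /forallP lt] ->] := lead_attained PF.
  apply: lead_ge; rewrite /divides et; apply/forallP => v.
  exact: leq_trans (lt v) (shift_anti _ GF v).
have [F0 /andP[PF0 /eqP k0] _] := nzH_ex Hk.
have [t /andP[et /forallP lt0] lk] := lead_attained PF0; rewrite k0 in lk.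
pose b' v := b v - dg t v.
have tb v : dg t v <= b v by apply: leq_trans (lt0 v) _; rewrite ffunE leq_subr.
(* The monomials of larger lead contribute to the colon ideal by [m] exactly the
   variables in [U]. *)
pose U := [set v | [exists t' : s.-tuple ('I_n * 'I_n), [&& edges e t', k < lexw B (dg t') &
   [forall u, dg t' u <= dg t u + (u == v)]]]].
pose D G := colon_complex e t G && [disjoint U & G].
have shE F : supp (fun v => shift b F v - dg t v) = supp (fun v => b' v - (v \in F)).
  by apply/setP => v; rewrite !inE ffunE /b' subnAC.
have symbE F : (forall v, dg t v <= shift b F v) ->
    symb_pow e s.+1 (shift b F) = ~~ colon_complex e t (supp (fun v => b' v - (v \in F))).
  by move=> le; have := symb_pow_colon et le; rewrite size_tuple => ->; rewrite shE.
(* A variable of [U] in the cofactor would admit a divisor larger than [m]; conversely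
   [linear_quotient] turns any larger divisor into such a variable. *)
have E F : (P F && (lead F == k)) = (F \subset supp b') && D (supp (fun v => b' v - (v \in F))).
  apply/idP/andP => [/andP[PF /eqP kF]|[FW /andP[lF /pred0P dF]]].
    have [t1 /andP[et1 /forallP lt1] lk1] := lead_attained PF.
    have Et : dg t1 =1 dg t by apply: lexw_inj (dgB t1) (dgB t) _; rewrite -lk -lk1 kF.
    have le v : dg t v <= shift b F v by rewrite -Et.
    have /andP[/andP[/forall_inP b0 _] NJ] := PF; split.
      apply/subsetP => v vF; have := le v; have := b0 v vF.
      by rewrite inE /b' ffunE vF; lia.
    rewrite /D; rewrite symbE // negbK in NJ; rewrite NJ /=.
    apply/pred0P => v; apply/negP => /andP[]; rewrite !inE.
    move=> /existsP[t' /and3P[et' kt' /forallP lt']] v0.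
    have : lexw B (dg t') <= lead F.
      apply: lead_ge; rewrite /divides et'; apply/forallP => u.
      apply: leq_trans (lt' u) _; have [->|_] := eqVneq u v; last by rewrite addn0.
      by have := le v; move: v0; rewrite ffunE /b'; lia.
    by rewrite kF leqNgt kt'.
  have le v : dg t v <= shift b F v.
    rewrite ffunE; have [vF|_] := boolP (v \in F); last by rewrite subn0.
    by have := subsetP FW v vF; rewrite inE /b'; lia.
  have dt : divides t (shift b F) by rewrite /divides et; apply/forallP.
  have NJ : ~~ symb_pow e s.+1 (shift b F) by rewrite symbE // negbK.
  have PF : P F.
    rewrite /P NJ andbT; apply/andP; split.
      by apply/forall_inP => v /(subsetP FW); rewrite inE /b'; lia.
    by apply/powP; exists t; rewrite size_tuple.
  rewrite PF eqn_leq /= [X in _ && X](_ : _ = true) ?andbT; last by rewrite lk lead_ge.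
  have [t1 /andP[et1 /forallP lt1] lk1] := lead_attained PF.
  rewrite leqNgt; apply/negP; rewrite lk lk1 => lt.
  have [|||v [es [vw ees ses les lu]]] 
    := @linear_quotient n e e_sym t t1 (shift b F) et et1 _ le lt1.
  - by rewrite !size_tuple.
  - by rewrite size_tuple.
  - by rewrite size_tuple.
  rewrite size_tuple in ses les.
  have := dF v; rewrite /= !inE => /negP[]; apply/andP; split; last first.
    by move: vw; rewrite ffunE /b' subnAC subn_gt0.
  apply/existsP; exists (Tuple (introT eqP ses)); rewrite /= ees lk les /=.
  exact/forallP.
have {}Hk := nzH_eq E Hk.
(* [D] sees only supports, so an exponent above 1 makes [v] a cone apex. *)
have b'1 v : b' v <= 1.
  rewrite leqNgt; apply/negP => b2; apply: (nzH_cone (k := v)) Hk => F vF.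
  rewrite subUset sub1set [v \in _]inE (ltnW b2) /=; congr (_ && D _).
  apply/setP => u; rewrite !inE; have [->|//] := eqVneq u v.
  by rewrite (negPf vF) subn0 subn_gt0 b2 (ltnW b2).
pose W := supp b'.
have dD : downclosed D.
  move=> F G GF /andP[lF dF]; apply/andP; split; first exact: (colon_complex_flag e t).1 GF lF.
  by rewrite disjoint_sym (disjointWl GF) // disjoint_sym.
have : nzH K (fun F => (F \subset W) && D (W :\: F)) i.
  apply: nzH_eq Hk => F; congr (_ && D _); apply/setP => v; rewrite !inE.
  by have := b'1 v; case: (v \in F) => /=; lia.
case/(nzH_coH K W i dD) => j ij HD.
have {}HD : coH K (restr (colon_complex e t) (W :\: U)) j.
  apply: coH_eq HD => G; rewrite /restr /D subsetD -andbA; congr (_ && _).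
  by rewrite andbC disjoint_sym.
have [W' HI] := coH_colon_complex et HD.
have := reg_edge_ideal_ge exE HI.
(* Since [i + j = #|W|], this turns [j.+1 <= reg] into the claim. *)
have -> : \sum_v b v = #|W| + s.*2.
  have -> : #|W| = \sum_v (v \in W).
    by rewrite -sum1_card [LHS]big_mkcond; apply: eq_bigr => v _; case: (v \in W).
  rewrite -[X in _ = _ + X.*2](size_tuple t) -sum_dgT -big_split /=.
  apply: eq_bigr => v _; rewrite inE -{1}(subnK (tb v)) -/(b' v); congr (_ + _).
  by have := b'1 v; case: (b' v) => [|[]].
by rewrite -ij; lia.
Qed.
End QuotientBound.
End RegularityBound.

Theorem theorem3p8 (K : fieldType) (n : nat) (e : rel 'I_n)
  (e_sym : symmetric e) (e_irr : irreflexive e)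
  (e_nonempty : exists i j, e i j)
  (s : nat) (hs : (1 <= s)%N)
  (hcyc : forall l : nat, odd l -> (l + 3 <= 2 * s)%N -> ~ has_cycle_of_length e l) :
  (reg K (symb_pow e s.+1)
     <= Num.max (reg K (edge_ideal e) + Posz (2 * s)) (reg K (edge_ideal_pow e s)))%R.
Proof.
have upJ := @symb_up n e s.+1; have upL := @pow_up n e s.
have JL (b : mono n) : symb_pow e s.+1 b -> edge_ideal_pow e s b by apply: symb_sub_pow.
have exJ : exists b, symb_pow e s.+1 b.
  have [x [y xy]] := e_nonempty; exists [ffun=> s.+1]; apply/symb_powP => C /vertex_coverP vC.
  have [z zC] : exists z, z \in C by case/orP: (vC x y xy) => ?; [exists x|exists y].
  by rewrite (bigD1 z) //= ffunE leq_addr.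
have exL : exists b, edge_ideal_pow e s b by have [b Jb] := exJ; exists b; apply: JL.
(* The regularity is attained, so a single nonzero Betti number has to be bounded. *)
have [_ [i [b [bt <-]]]] := reg_is_reg K upJ (@symb_stable n e s.+1) exJ.
have regL := reg_is_reg K upL (@pow_stable n e s) exL.
move/(betti_nzH K b upJ): bt => H.
case: (@nzH_sub K n (koszul (edge_ideal_pow e s) b) (koszul (symb_pow e s.+1) b)
  (fun F => koszul (edge_ideal_pow e s) b F && ~~ symb_pow e s.+1 (shift b F)) _ _ _ _ i H).
- by move=> F G G' _ GG' _; apply: koszul_down.
- move=> F; rewrite /koszul; have := JL (shift b F).
  by case: (symb_pow _ _ _) => [/(_ isT)->|_]; rewrite ?andbT ?andbF ?orbF.
- by move=> F /andP[_ ->]; rewrite andbF.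
- by move=> F G GF JF _; apply: koszul_down JF.
- by move=> /(le_reg upL regL) le; rewrite le_max le orbT.
(* The class of the quotient lies in homological degree [i.+1], which absorbs the [+ 1] of the
   bound. *)
move=> /(koszul_quotient_bound e_sym e_nonempty) le; rewrite le_max; apply/orP; left.
by apply: le_trans le; lia.
Qed.
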